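(* Suppose Assumption A (constant $d$), Assumption E (constants $C_\lambda,L_\lambda$) and Assumption O (constant $\kappa^\circ$) hold. If in addition $(\log G_\epsilon)/m^\circ_\epsilon\to0$ as $\epsilon\to0$, then with $D^\circ:=\lceil5L_\lambda/\kappa^\circ\rceil$ and $K^\circ:=10\big((1+1/d)\vee\|\theta^\circ-\eta\|^2/d^2\big)L_\lambda^2\big(8C_\lambda(1+1/d)\vee D^\circ\Lambda_{(D^\circ)}\big)$, $$\lim_{\epsilon\to0}\mathbb E_{\theta^\circ}P_{\vartheta^M|Y}\Big((K^\circ)^{-1}\Phi^\circ_\epsilon\le\|\vartheta^M-\theta^\circ\|^2\le K^\circ\Phi^\circ_\epsilon\Big)=1.$$
   Context: Let $\ell^2$ be the space of square-summable real sequences with norm $\|\cdot\|$. Fix a bounded real sequence $\lambda=(\lambda_j)_{j\ge1}$ with $\lambda_j\ne0$ for all $j$, a noise level $\epsilon\in(0,1)$ and a true parameter $\theta^\circ\in\ell^2$. The data $Y=(Y_j)_{j\ge1}$ satisfy $Y_j=\lambda_j\theta^\circ_j+\sqrt\epsilon\,\xi_j$ with $\xi_j$ i.i.d. $N(0,1)$; $\mathbb E_{\theta^\circ}$ denotes expectation under this law. Fix prior means $\eta=(\eta_j)_{j\ge1}$ with $\theta^\circ-\eta\in\ell^2$ and prior variances $\tau_j\in(0,\infty)$ (possibly depending on $\epsilon$). For $m\in\mathbb N$ the sieve prior is the law of $\vartheta^m$ with independent coordinates, $\vartheta^m_j\sim N(\eta_j,\tau_j)$ for $j\le m$ and $\vartheta^m_j=\eta_j$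 a.s. for $j>m$; put $\sigma_j:=(\lambda_j^2\epsilon^{-1}+\tau_j^{-1})^{-1}$, $\theta^Y_j:=\sigma_j(\tau_j^{-1}\eta_j+\lambda_j\epsilon^{-1}Y_j)$; the posterior $P_{\vartheta^m|Y}$ makes the coordinates independent with $\vartheta^m_j\sim N(\theta^Y_j,\sigma_j)$ for $j\le m$ and $\vartheta^m_j=\eta_j$ for $j>m$; $\hat\theta^m_j:=\theta^Y_j$ for $j\le m$, $\hat\theta^m_j:=\eta_j$ for $j>m$. Define $b_m:=\sum_{j>m}(\theta^\circ_j-\eta_j)^2$, $\Lambda_j:=\lambda_j^{-2}$, $\Lambda_{(m)}:=\max_{1\le j\le m}\Lambda_j$, $\bar\Lambda_m:=m^{-1}\sum_{j=1}^m\Lambda_j$, $\Phi^m_\epsilon:=b_m\vee\epsilon m\bar\Lambda_m$, $m^\circ_\epsilon:=\min\{m\ge1:\Phi^m_\epsilon\le\Phi^k_\epsilon\ \forall k\ge1\}$, $\Phi^\circ_\epsilon:=\min_{m\ge1}\Phi^m_\epsilon$. Let $G_\epsilon:=\max\{1\le m\le\lfloor\epsilon^{-1}\rfloor:\epsilon\Lambda_{(m)}\le\Lambda_1\}$. Assumption A: there is $d>0$ with $\tau_j\ge d\,(\epsilon^{1/2}\Lambda_j^{1/2}\vee\epsilon\Lambda_j)$ for all $1\le j\le G_\epsilon$, $\epsilon\in(0,1)$. Assumption E: there are constants $C_\lambda\ge1$, $L_\lambda\ge1$ such that for all $k,l\in\mathbb N$: (i) $\sup_{j>k}\lambda_j^2\le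 C_\lambda\min_{1\le j\le k}\lambda_j^2=C_\lambda\Lambda_{(k)}^{-1}$; (ii) $\Lambda_{(kl)}\le\Lambda_{(k)}\Lambda_{(l)}$; (iii) $\Lambda_{(k)}/\bar\Lambda_k\le L_\lambda$. Fix $\epsilon_o\in(0,1)$. Assumption O: $\kappa^\circ:=\inf_{0<\epsilon<\epsilon_o}(\Phi^\circ_\epsilon)^{-1}[b_{m^\circ_\epsilon}\wedge\epsilon m^\circ_\epsilon\bar\Lambda_{m^\circ_\epsilon}]>0$. Hierarchical prior: a random dimension $M$ with values in $\{1,\dots,G_\epsilon\}$ and $P(M=m)\propto\exp(-3C_\lambda m/2)\prod_{j=1}^m(\tau_j/\sigma_j)^{1/2}$; conditionally on $M=m$ the parameter $\vartheta^M$ has the law of $\vartheta^m$, and $Y_j=\lambda_j\vartheta^M_j+\sqrt\epsilon\xi_j$. The posterior of $M$ is $P_{M|Y}(M=m)=\exp(\frac12\{\|\hat\theta^m-\eta\|_\sigma^2-3C_\lambda m\})/\sum_{k=1}^{G_\epsilon}\exp(\frac12\{\|\hat\theta^k-\eta\|_\sigma^2-3C_\lambda k\})$ with $\|x\|_\sigma^2:=\sum_j x_j^2/\sigma_j$, and the posterior of $\vartheta^M$ is the mixture $P_{\vartheta^M|Y}=\sum_{m=1}^{G_\epsilon}P_{M|Y}(M=m)\,P_{\vartheta^m|Y}$. *)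

(* Defs.v *)
(* Sequences are indexed by nat with k <-> j = k+1. *)
From HB Require Import structures.
From mathcomp Require Import all_boot all_order all_algebra.
From mathcomp Require Import all_classical all_reals all_analysis.
Set Implicit Arguments. Unset Strict Implicit. Unset Printing Implicit Defensive.
Import Order.TTheory GRing.Theory Num.Def Num.Theory.
Import numFieldNormedType.Exports.
Local Open Scope classical_set_scope.
Local Open Scope ring_scope.

Section Defs.
Variable R : realType.
Implicit Types (lam thet eta x : nat -> R) (eps : R) (m k : nat).

Definition ell2 x := exists M : R, forall n, \sum_(k < n) x k ^+ 2 <= M.

Definition bounded_seq x := exists B : R, forall k, `|x k| <= B.

Definition sqnorm x : \bar R := (\sum_(k <oo) ((x k) ^+ 2)%:E)%E.

Definition Lam lam k : R := (lam k ^+ 2)^-1.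
Definition LamMax lam m : R := \big[Num.max/0]_(k < m) Lam lam k.
Definition LamBar lam m : R := (\sum_(k < m) Lam lam k) / m%:R.

Definition bias thet eta m : R :=
  limn (fun n => \sum_(m <= k < n) (thet k - eta k) ^+ 2).

Definition Phi lam thet eta eps m : R :=
  Num.max (bias thet eta m) (eps * m%:R * LamBar lam m).

Definition is_mo lam thet eta eps m : Prop :=
  [/\ (1 <= m)%N,
      (forall k, (1 <= k)%N -> Phi lam thet eta eps m <= Phi lam thet eta eps k) &
      (forall m', (1 <= m')%N ->
         (forall k, (1 <= k)%N -> Phi lam thet eta eps m' <= Phi lam thet eta eps k) ->
         (m <= m')%N)].

Definition mo lam thet eta eps : nat := xget 1%N (is_mo lam thet eta eps).

Definition Phio lam thet eta eps : R := Phi lam thet eta eps (mo lam thet eta eps).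

Definition Geps lam eps : nat :=
  \max_(m < (Num.truncn (eps^-1)).+1 | (1 <= m)%N && (eps * LamMax lam m <= Lam lam 0%N)) m.

Definition kappao lam thet eta (eps_o : R) : R :=
  inf [set (Phio lam thet eta eps)^-1 *
           Num.min (bias thet eta (mo lam thet eta eps))
                   (eps * (mo lam thet eta eps)%:R * LamBar lam (mo lam thet eta eps))
      | eps in `]0, eps_o[ ].

Definition AssumptionA lam (tau : R -> nat -> R) (d : R) : Prop :=
  0 < d /\
  forall eps, 0 < eps < 1 -> forall k, (k < Geps lam eps)%N ->
    d * Num.max (Num.sqrt (eps * Lam lam k)) (eps * Lam lam k) <= tau eps k.

Definition AssumptionE lam (C L : R) : Prop :=
  [/\ 1 <= C, 1 <= L,
      (forall k, (1 <= k)%N -> forall j, (k <= j)%N ->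
          lam j ^+ 2 <= C * (LamMax lam k)^-1),
      (forall k l, (1 <= k)%N -> (1 <= l)%N ->
          LamMax lam (k * l) <= LamMax lam k * LamMax lam l) &
      (forall k, (1 <= k)%N -> LamMax lam k / LamBar lam k <= L)].

Definition AssumptionO lam thet eta (eps_o : R) : Prop :=
  0 < kappao lam thet eta eps_o.

Definition sig lam (tau : R -> nat -> R) eps k : R :=
  (lam k ^+ 2 / eps + (tau eps k)^-1)^-1.

Definition thetaY lam tau eta eps (y : nat -> R) k : R :=
  sig lam tau eps k * ((tau eps k)^-1 * eta k + lam k / eps * y k).

Definition nsig lam tau eta eps y m : R :=
  \sum_(k < m) (thetaY lam tau eta eps y k - eta k) ^+ 2 / sig lam tau eps k.

Definition postM lam tau eta (C : R) eps y m : R :=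
  expR ((nsig lam tau eta eps y m - 3 * C * m%:R) / 2) /
  \sum_(1 <= k < (Geps lam eps).+1)
     expR ((nsig lam tau eta eps y k - 3 * C * k%:R) / 2).

Definition Do lam thet eta (L : R) eps_o : nat :=
  `|Num.ceil (5 * L / kappao lam thet eta eps_o)|%N.

Definition Ko lam thet eta (d C L : R) eps_o : R :=
  let D := Do lam thet eta L eps_o in
  10 * Num.max (1 + d^-1) (bias thet eta 0 / d ^+ 2) * L ^+ 2 *
  Num.max (8 * C * (1 + d^-1)) (D%:R * LamMax lam D).

End Defs.

Definition iid_std_normal {R : realType} {d : measure_display}
  {T : measurableType d} (P : probability T R) (xi : nat -> T -> R) : Prop :=
  [/\ (forall k, measurable_fun setT (xi k)),
      (forall k (B : set R), measurable B -> P (xi k @^-1` B) = normal_prob 0 1 B) &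
      (forall (s : seq nat) (B : nat -> set R), uniq s ->
         (forall k, measurable (B k)) ->
         P (\bigcap_(k in [set k | k \in s]) (xi k @^-1` B k)) =
         (\prod_(k <- s) P (xi k @^-1` B k))%E)].

(* Main.v *)
(**
Every estimate is a Chernoff bound for a weighted sum of squares of independent
Gaussians.  Up to the factor 1/2 and the penalty, the log-odds of the dimension m
against the oracle dimension m0 are
  +/- \sum_k a_k (mu_k + xi_k)^2,
k running between m and m0, with shrinkage factors a_k in [1/(1+1/d), 1] and
a_k mu_k^2 = a_k (thet_k - eta_k)^2 / (eps Lam_k).  As P(M = m | Y) is at most the
odds, and at most their square root, its expectation is at most an exponential
moment of this sum.  This is exponentially small in m0 when m < m0 and the bias at
m exceeds 8 L C (1 + 1/d) Phio (the signal in the omitted coordinates is too large),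
and when m > D m0 (the penalty dominates).  For the remaining m, the squared
distance of a posterior draw to thet is a bias plus a sum of Gaussian squares, both
conditionally on Y and under the law of Y, and its tails beyond K Phio and below
Phio / K are again O(exp(- c m0)).  Summing over m <= G, the expected posterior mass
lost is at most 2 G exp(- c m0), which vanishes because ln G = o(m0).

The posterior mass need not be shown measurable in Y: it is bounded below by one
minus explicit measurable functions, and the integral of a nonnegative function is
monotone without any measurability.
*)

Require Import Defs.
From HB Require Import structures.
From mathcomp Require Import all_boot all_order all_algebra.
From mathcomp Require Import all_classical all_reals all_analysis.
From mathcomp Require Import measurable_realfun ring lra.
Import Order.TTheory GRing.Theory Num.Def Num.Theory.
Import numFieldNormedType.Exports.
Local Open Scope classical_set_scope.
Local Open Scope ring_scope.
Set Implicit Arguments.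
Unset Strict Implicit.

(** * Independence and exponential moments of Gaussian squares *)

Section density_transfer.
Import HBNNSimple.
Local Open Scope ereal_scope.

Lemma ge0_integral_density_transfer (R : realType) (d1 d2 : measure_display)
  (X : measurableType d1) (Y : measurableType d2)
  (mu : {measure set X -> \bar R}) (nu : {measure set Y -> \bar R})
  (phi : X -> Y) (W : X -> R) (c : R) (f : Y -> R) :
  measurable_fun setT phi -> measurable_fun setT W -> (forall x, (0 <= W x)%R) ->
  (forall B, measurable B -> \int[mu]_x (W x * \1_B (phi x))%:E = c%:E * nu B) ->
  measurable_fun setT f -> (forall y, (0 <= f y)%R) ->
  \int[mu]_x (W x * f (phi x))%:E = c%:E * \int[nu]_y (f y)%:E.
Proof.
move=> mphi mW W0 HB mf f0.
have /measurable_EFinP mEf := mf.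
pose f_ := nnsfun_approx measurableT mEf.
have cvgf y : EFin \o f_^~ y @ \oo --> (f y)%:E.
  by apply: (cvg_nnsfun_approx measurableT mEf) => // z _; rewrite lee_fin.
have mWf n : measurable_fun setT (fun x => W x * f_ n (phi x))%R.
  by apply: measurable_funM => //; apply: measurableT_comp.
transitivity (limn (fun n => \int[mu]_x (W x * f_ n (phi x))%:E)).
  rewrite -monotone_convergence//.
  - apply: eq_integral => x _; apply/esym/cvg_lim => //.
    under eq_fun do rewrite EFinM.
    by rewrite EFinM; apply: cvgeZl => //; exact: cvgf.
  - by move=> n; exact/measurable_EFinP.
  - by move=> n x _; rewrite lee_fin mulr_ge0.
  - move=> x _ m n mn; rewrite lee_fin ler_wpM2l//.
    exact/lefP/nd_nnsfun_approx.
have -> : \int[nu]_y (f y)%:E = limn (fun n => \int[nu]_y (f_ n y)%:E).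
  rewrite -monotone_convergence//.
  - by apply: eq_integral => y _; apply/esym/cvg_lim => //; exact: cvgf.
  - by move=> n; exact/measurable_EFinP.
  - by move=> n y _; rewrite lee_fin.
  - by move=> y _ m n mn; rewrite lee_fin; exact/lefP/nd_nnsfun_approx.
have ndI : nondecreasing_seq (fun n => \int[nu]_y (f_ n y)%:E).
  move=> m n mn; apply: ge0_le_integral => //.
  - by move=> y _; rewrite lee_fin.
  - exact/measurable_EFinP.
  - exact/measurable_EFinP.
  - by move=> y _; rewrite lee_fin; exact/lefP/nd_nnsfun_approx.
rewrite -limeMl//; last 1 first.
- exact: ereal_nondecreasing_is_cvgn.
congr (limn _); apply/funext => n.
have mB r : measurable (f_ n @^-1` [set r]) by [].
transitivity (\sum_(r \in range (f_ n))
    \int[mu]_x (r%:E * (W x * \1_(f_ n @^-1` [set r]) (phi x))%:E)).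
  rewrite -ge0_integral_fsum//.
  - apply: eq_integral => x _; rewrite fsumEFin//; congr EFin.
    by rewrite fimfunE mulr_fsumr//; apply: eq_fsbigr => r _; ring.
  - move=> r; apply/measurable_EFinP; apply: measurable_funM => //.
    apply: measurable_funM => //.
    by apply: measurableT_comp => //; exact: measurable_indic.
  - move=> r x _; rewrite -EFinM mulrCA mulrA -mulrA EFinM mule_ge0 ?lee_fin//.
    by rewrite -lee_fin EFinM nnfun_muleindic_ge0.
transitivity (\sum_(r \in range (f_ n)) c%:E * (r%:E * nu (f_ n @^-1` [set r]))).
  apply: eq_fsbigr => r; rewrite inE => -[y _ <-].
  rewrite ge0_integralZl_EFin//.
  - by rewrite HB// muleCA.
  - by move=> x _; rewrite lee_fin mulr_ge0.
  - apply/measurable_EFinP; apply: measurable_funM => //.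
    by apply: measurableT_comp => //; exact: measurable_indic.
rewrite -ge0_mule_fsumr; last by move=> r; rewrite nnsfun_mulemu_ge0.
by congr (_ * _); rewrite integral_nnsfun// patch_setT sintegralE.
Qed.
End density_transfer.

Lemma expectation_prod_iid_normal (R : realType) (d : measure_display)
  (T : measurableType d) (P : probability T R) (xi : nat -> T -> R) (m n : nat)
  (f : nat -> R -> R) (c : nat -> R) :
  iid_std_normal P xi ->
  (forall k, measurable_fun setT (f k)) -> (forall k x, 0 <= f k x) ->
  (forall k, \int[normal_prob 0 1]_x (f k x)%:E = (c k)%:E)%E ->
  (\int[P]_w (\prod_(m <= k < n) f k (xi k w))%:E =
   (\prod_(m <= k < n) c k)%:E)%E.
Proof.
move=> [mxi lawxi indepxi].
(* Induction on j: only the first j factors are arbitrary functions, the others are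
   indicators, for which the claim is the definition of independence. *)
suff H j (g : nat -> R -> R) (e : nat -> R) :
    (forall k, measurable_fun setT (g k)) -> (forall k x, 0 <= g k x) ->
    (forall k, \int[normal_prob 0 1]_x (g k x)%:E = (e k)%:E)%E ->
    (forall k, (m <= k < n)%N -> (j <= k)%N -> exists2 B, measurable B & g k = \1_B) ->
    (\int[P]_w (\prod_(m <= k < n) g k (xi k w))%:E =
     (\prod_(m <= k < n) e k)%:E)%E.
  move=> mf f0 fc; apply: (H n) => // k /andP[_ kn] nk.
  by move: (leq_ltn_trans nk kn); rewrite ltnn.
elim: j g e => [|j IH] g e mg g0 ge gB.
  have /choice[B hB] : forall k, exists B,
      measurable B /\ ((m <= k < n)%N -> g k = \1_B).
    move=> k; have [kn|kn] := boolP (m <= k < n)%N; last by exists set0; split.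
    by have [B mB ->] := gB k kn (leq0n k); exists B.
  have mB k := (hB k).1.
  have {}hB k kn := (hB k).2 kn.
  under eq_integral => w _.
    rewrite (_ : \prod_(m <= k < n) _ =
        \1_(\bigcap_(k in [set k | k \in index_iota m n]) (xi k @^-1` B k)) w).
      over.
    have [/= capw|] :=
      pselect ((\bigcap_(k in [set k | k \in index_iota m n]) (xi k @^-1` B k)) w).
      rewrite [RHS]indicE mem_set// big_nat big1// => k kn.
      by rewrite hB// indicE mem_set//; apply: capw; rewrite /= mem_index_iota.
    move=> ncap; rewrite [RHS]indicE memNset//.
    have [k kn nBk] : exists2 k, (m <= k < n)%N & ~ B k (xi k w).
      apply: contrapT => h; apply: ncap => k /=; rewrite mem_index_iota /= => kn.
      by apply: contrapT => nB; apply: h; exists k.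
    rewrite (bigD1_seq k) ?mem_index_iota ?iota_uniq//=.
    by rewrite hB// indicE memNset// mul0r.
  rewrite integral_indic//; last first.
    apply: bigcap_measurableType => // k _.
    by rewrite -[X in measurable X]setTI; exact: mxi.
  rewrite setIT.
  transitivity (\prod_(k <- index_iota m n) P (xi k @^-1` B k))%E.
    by apply: indepxi => //; exact: iota_uniq.
  rewrite -prodEFin !big_nat; apply: eq_bigr => k kn.
  by rewrite lawxi// -ge hB// integral_indic ?setIT//; exact: mB.
have [mjn|nmjn] := boolP (m <= j < n)%N; last first.
  apply: IH => // k mkn jk; apply: gB => //.
  by rewrite ltn_neqAle jk andbT; apply: contraNneq nmjn => ->.
have splitj (F : nat -> R) :
    \prod_(m <= k < n) F k = (\prod_(m <= k < n | k != j) F k) * F j.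
  by rewrite mulrC (bigD1_seq j) ?mem_index_iota ?iota_uniq.
rewrite splitj; under eq_integral do rewrite splitj.
have mW : measurable_fun setT
    (fun w => \prod_(m <= k < n | k != j) g k (xi k w)).
  under eq_fun do rewrite big_mkcond.
  apply: (@measurable_prod _ _ _ _ _ _
    (fun k w => if k != j then g k (xi k w) else 1)) => k _.
  by case: (k != j) => //; exact: measurableT_comp.
rewrite (@ge0_integral_density_transfer _ _ _ _ _ _ (normal_prob 0 1) (xi j) _
  (\prod_(m <= k < n | k != j) e k))//.
- by rewrite ge EFinM.
- exact: mxi.
- by move=> w; apply: prodr_ge0.
- move=> B mB.
  pose g' k := if k == j then \1_B else g k.
  pose e' k := if k == j then fine (normal_prob 0 1 B) else e k.
  have H1 : (\int[P]_w (\prod_(m <= k < n) g' k (xi k w))%:E =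
     (\prod_(m <= k < n) e' k)%:E)%E.
    apply: IH => [k|k x|k|k]; rewrite /g' /e'; have [_|kj] // := eqVneq k j.
    - by rewrite integral_indic// setIT fineK// fin_num_measure.
    - by exists B.
    - by move=> mkn jk; apply: gB => //; rewrite ltn_neqAle eq_sym kj.
  transitivity (\int[P]_w (\prod_(m <= k < n) g' k (xi k w))%:E)%E.
    apply: eq_integral => w _; rewrite splitj /g' eqxx.
    by congr (_ * _)%:E; apply: eq_bigr => k /negbTE ->.
  rewrite H1 splitj EFinM /e' eqxx fineK ?fin_num_measure//.
  by congr (_%:E * _)%E; apply: eq_bigr => k /negbTE ->.
- exact: mg.
Qed.

Lemma integral_std_normal (R : realType) (f : R -> R) :
  measurable_fun setT f -> (forall x, 0 <= f x) ->
  (\int[normal_prob 0 1]_x (f x)%:E =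
   \int[lebesgue_measure]_x (normal_pdf 0 1 x * f x)%:E)%E.
Proof.
move=> mf f0.
rewrite (@ge0_integral_density_transfer _ _ _ _ _ lebesgue_measure
  (normal_prob 0 1) id _ 1) ?mul1e//.
- exact: measurable_normal_pdf.
- exact: normal_pdf_ge0.
- move=> B mB; rewrite mul1e /normal_prob [RHS]integral_mkcond.
  by apply: eq_integral => x _; rewrite epatch_indic.
Qed.

Lemma std_normal_exp_sq (R : realType) (t a b : R) : 2 * t * b ^+ 2 < 1 ->
  (\int[normal_prob 0 1]_x (expR (t * (a + b * x) ^+ 2))%:E =
   ((Num.sqrt (1 - 2 * t * b ^+ 2))^-1 * expR (t * a ^+ 2 / (1 - 2 * t * b ^+ 2)))%:E)%E.
Proof.
set q := 1 - _ => tb1.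
have q0 : 0 < q by rewrite subr_gt0.
have sq0 : 0 < (Num.sqrt q)^-1 by rewrite invr_gt0 sqrtr_gt0.
rewrite integral_std_normal//; last first.
  apply: measurableT_comp => //; apply: measurable_funM => //.
  apply: measurable_funX; apply: measurable_funD => //.
transitivity (\int[lebesgue_measure]_x
    (((Num.sqrt q)^-1 * expR (t * a ^+ 2 / q))%:E *
     (normal_pdf (2 * t * a * b / q) (Num.sqrt q)^-1 x)%:E))%E.
  apply: eq_integral => x _; rewrite -EFinM; congr EFin.
  rewrite !normal_pdfE ?oner_eq0 ?gt_eqF//.
  rewrite /normal_peak /normal_fun.
  have peakE : Num.sqrt (q^-1 * pi *+ 2) = (Num.sqrt q)^-1 * Num.sqrt (pi *+ 2).
    by rewrite -mulrnAr sqrtrM ?invr_ge0 ?(ltW q0)// sqrtrV ?(ltW q0).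
  rewrite exprVn sqr_sqrtr ?(ltW q0)// expr1n mul1r peakE invfM invrK.
  set e1 := _ / (1 *+ 2); set e2 := _ / (q^-1 *+ 2).
  have eE : e1 + t * (a + b * x) ^+ 2 = t * a ^+ 2 / q + e2.
    by rewrite /e1 /e2 /q; field; rewrite -/q gt_eqF.
  rewrite -[LHS]mulrA -expRD eE expRD.
  have : Num.sqrt q != 0 by rewrite gt_eqF ?sqrtr_gt0.
  have : Num.sqrt (pi *+ 2) != 0 :> R.
    by rewrite gt_eqF// sqrtr_gt0 pmulrn_lgt0// pi_gt0.
  by move=> ? ?; field; apply/andP.
rewrite ge0_integralZl_EFin//.
- by rewrite integral_normal_pdf mule1.
- by move=> x _; rewrite lee_fin normal_pdf_ge0.
- by apply/measurable_EFinP; exact: measurable_normal_pdf.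
Qed.

Lemma measurable_exp_sq (R : realType) (t a b : R) :
  measurable_fun [set: R] (fun x => expR (t * (a + b * x) ^+ 2)).
Proof.
apply: measurableT_comp => //; apply: measurable_funM => //.
by apply: measurable_funX; apply: measurable_funD.
Qed.

Lemma invsqrt_le_expR (R : realType) (q y : R) : 0 < q -> expR (- (2 * y)) <= q ->
  (Num.sqrt q)^-1 <= expR y.
Proof.
move=> q0 yq; rewrite -[leRHS]invrK -expRN lef_pV2 ?posrE ?sqrtr_gt0 ?expR_gt0//.
rewrite -[leLHS]ger0_norm ?expR_ge0// -sqrtr_sqr ler_wsqrtr// -expRM_natl.
by rewrite mulrN.
Qed.

Lemma std_normal_exp_sq_up (R : realType) (t a b : R) :
  0 <= t -> 4 * t * b ^+ 2 <= 1 ->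
  (Num.sqrt (1 - 2 * t * b ^+ 2))^-1 * expR (t * a ^+ 2 / (1 - 2 * t * b ^+ 2))
    <= expR (2 * t * (a ^+ 2 + b ^+ 2)).
Proof.
move=> t0; set y := 2 * t * b ^+ 2 => y1.
have y0 : 0 <= y by rewrite /y; apply: mulr_ge0; [lra|exact: sqr_ge0].
have y12 : y <= 2^-1 by rewrite /y; lra.
rewrite mulrDr expRD mulrC; apply: ler_pM; rewrite ?expR_ge0 ?invr_ge0 ?sqrtr_ge0//.
  rewrite ler_expR ler_pdivrMr; last lra.
  rewrite -subr_ge0 (_ : _ - _ = t * a ^+ 2 * (1 - 2 * y)); last by ring.
  by apply: mulr_ge0; [by rewrite mulr_ge0 ?sqr_ge0|lra].
apply: invsqrt_le_expR; first lra.
rewrite expRN -[leRHS]invrK lef_pV2 ?posrE ?expR_gt0 ?invr_gt0//; last lra.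
apply: le_trans (expR_ge1Dx _); rewrite -/y -div1r ler_pdivrMr; last lra.
by nra.
Qed.

Lemma std_normal_exp_sq_down (R : realType) (t a b : R) :
  0 <= t -> 2 * t * b ^+ 2 <= 1 ->
  (Num.sqrt (1 - 2 * - t * b ^+ 2))^-1 *
    expR (- t * a ^+ 2 / (1 - 2 * - t * b ^+ 2))
    <= expR (- (t * (a ^+ 2 + b ^+ 2) / 2)).
Proof.
move=> t0; have -> : 1 - 2 * - t * b ^+ 2 = 1 + 2 * t * b ^+ 2 by ring.
set y := 2 * t * b ^+ 2 => y1.
have y0 : 0 <= y by rewrite /y; apply: mulr_ge0; [lra|exact: sqr_ge0].
rewrite mulrDr mulrDl opprD expRD mulrC.
apply: ler_pM; rewrite ?expR_ge0 ?invr_ge0 ?sqrtr_ge0//.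
  rewrite ler_expR ler_pdivrMr; last lra.
  rewrite -subr_ge0 (_ : _ - _ = t * a ^+ 2 * ((1 - y) / 2)); last by field.
  by apply: mulr_ge0; [by rewrite mulr_ge0 ?sqr_ge0|lra].
apply: invsqrt_le_expR; first lra.
rewrite mulrN opprK (_ : 2 * _ = y / 2); last by rewrite /y; field.
rewrite -[y / 2]opprK expRN -[leRHS]invrK lef_pV2 ?posrE ?expR_gt0 ?invr_gt0//; last lra.
apply: le_trans (expR_ge1Dx _); rewrite -div1r ler_pdivrMr; last lra.
by nra.
Qed.

Section expectation_bounds.
Context (R : realType) (d : measure_display) (T : measurableType d).
Variables (P : probability T R) (xi : nat -> T -> R).
Hypothesis iidxi : iid_std_normal P xi.

Let expectation_exp_sum_le m n (s a b u : nat -> R) :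
  (forall k, 2 * s k * b k ^+ 2 < 1) ->
  (forall k, (Num.sqrt (1 - 2 * s k * b k ^+ 2))^-1 *
     expR (s k * a k ^+ 2 / (1 - 2 * s k * b k ^+ 2)) <= expR (u k)) ->
  (\int[P]_w (expR (\sum_(m <= k < n) s k * (a k + b k * xi k w) ^+ 2))%:E
    <= (expR (\sum_(m <= k < n) u k))%:E)%E.
Proof.
move=> s1 su.
under eq_integral do rewrite expR_sum.
rewrite (@expectation_prod_iid_normal _ _ _ _ _ _ _
  (fun k x => expR (s k * (a k + b k * x) ^+ 2))
  (fun k => (Num.sqrt (1 - 2 * s k * b k ^+ 2))^-1 *
     expR (s k * a k ^+ 2 / (1 - 2 * s k * b k ^+ 2))) iidxi); last first.
- by move=> k; rewrite std_normal_exp_sq.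
- by move=> k x; exact: expR_ge0.
- by move=> k; exact: measurable_exp_sq.
rewrite lee_fin expR_sum; apply: ler_prod => k _; rewrite su andbT.
by rewrite mulr_ge0 ?expR_ge0 ?invr_ge0 ?sqrtr_ge0.
Qed.

Lemma expectation_exp_sum_up m n (t a b : nat -> R) :
  (forall k, (m <= k < n)%N -> 0 <= t k) ->
  (forall k, (m <= k < n)%N -> 4 * t k * b k ^+ 2 <= 1) ->
  (\int[P]_w (expR (\sum_(m <= k < n) t k * (a k + b k * xi k w) ^+ 2))%:E
    <= (expR (\sum_(m <= k < n) 2 * t k * (a k ^+ 2 + b k ^+ 2)))%:E)%E.
Proof.
move=> t0 t1; pose s k := if (m <= k < n)%N then t k else 0.
have sE (F : nat -> R -> R) :
    \sum_(m <= k < n) F k (t k) = \sum_(m <= k < n) F k (s k).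
  by rewrite !big_nat; apply: eq_bigr => k /= kn; rewrite /s kn.
have s0 k : 0 <= s k by rewrite /s; case: ifPn => // kn; exact: t0.
have s1 k : 4 * s k * b k ^+ 2 <= 1.
  by rewrite /s; case: ifPn => [|_]; [exact: t1|rewrite mulr0 mul0r].
under eq_integral do rewrite (sE (fun k x => x * (a k + b k * xi k _) ^+ 2)).
rewrite (sE (fun k x => 2 * x * (a k ^+ 2 + b k ^+ 2))).
apply: expectation_exp_sum_le => k; first by have := s1 k; lra.
exact: std_normal_exp_sq_up.
Qed.

Lemma expectation_exp_sum_down m n (t a b : nat -> R) :
  (forall k, (m <= k < n)%N -> 0 <= t k) ->
  (forall k, (m <= k < n)%N -> 2 * t k * b k ^+ 2 <= 1) ->
  (\int[P]_w (expR (- \sum_(m <= k < n) t k * (a k + b k * xi k w) ^+ 2))%:E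
    <= (expR (- ((\sum_(m <= k < n) t k * (a k ^+ 2 + b k ^+ 2)) / 2)))%:E)%E.
Proof.
move=> t0 t1; pose s k := if (m <= k < n)%N then t k else 0.
have sE (F : nat -> R -> R) :
    \sum_(m <= k < n) F k (t k) = \sum_(m <= k < n) F k (s k).
  by rewrite !big_nat; apply: eq_bigr => k /= kn; rewrite /s kn.
have s0 k : 0 <= s k by rewrite /s; case: ifPn => // kn; exact: t0.
have s1 k : 2 * s k * b k ^+ 2 <= 1.
  by rewrite /s; case: ifPn => [|_]; [exact: t1|rewrite mulr0 mul0r].
under eq_integral do
  rewrite (sE (fun k x => x * (a k + b k * xi k _) ^+ 2)) -sumrN.
rewrite (sE (fun k x => x * (a k ^+ 2 + b k ^+ 2))) mulr_suml -sumrN.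
under eq_integral do under eq_bigr do rewrite -mulNr.
apply: expectation_exp_sum_le => k; last exact: std_normal_exp_sq_down.
by have := s0 k; have := sqr_ge0 (b k); nra.
Qed.

End expectation_bounds.

(** * Bias, variance and the oracle dimension *)

Section bias_theory.
Context (R : realType) (thet eta : nat -> R).
Hypothesis ell2d : ell2 (fun k => thet k - eta k).
Local Notation delta2 k := ((thet k - eta k) ^+ 2).

Let nd_tail m : nondecreasing_seq (fun n => \sum_(m <= k < n) delta2 k).
Proof.
move=> a b ab; have [ma|am] := leqP m a.
  by rewrite [leRHS](big_cat_nat ma ab)/= lerDl sumr_ge0// => k _; exact: sqr_ge0.
by rewrite big_geq ?(ltnW am)// sumr_ge0// => k _; exact: sqr_ge0.
Qed.

Let is_cvg_tail m : cvgn (fun n => \sum_(m <= k < n) delta2 k).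
Proof.
apply: nondecreasing_is_cvgn; first exact: nd_tail.
have [M hM] := ell2d; exists M => _ [n _ <-].
have [mn|nm] := leqP m n.
  apply: le_trans (hM n); rewrite -(big_mkord xpredT (fun k => delta2 k)).
  by rewrite [leRHS](big_cat_nat (leq0n m) mn)/= lerDr sumr_ge0// => k _; exact: sqr_ge0.
by rewrite big_geq ?(ltnW nm)//; have := hM 0%N; rewrite big_ord0.
Qed.

Lemma bias_split m n : (m <= n)%N ->
  bias thet eta m = \sum_(m <= k < n) delta2 k + bias thet eta n.
Proof.
move=> mn; rewrite /bias; apply/cvg_lim => //.
have H : (fun N => \sum_(m <= k < n) delta2 k + \sum_(n <= k < N) delta2 k) @ \oo
    --> \sum_(m <= k < n) delta2 k + limn (fun N => \sum_(n <= k < N) delta2 k).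
  by apply: cvgD; [exact: cvg_cst|exact: is_cvg_tail].
apply: cvg_trans H; apply: near_eq_cvg; near=> N.
by rewrite -big_cat_nat//=; near: N; exists n.
Unshelve. all: by end_near. Qed.

Lemma bias_ge0 m : 0 <= bias thet eta m.
Proof.
apply: limr_ge; first exact: is_cvg_tail.
by apply: nearW => n; rewrite sumr_ge0// => k _; exact: sqr_ge0.
Qed.

Lemma bias_le m n : (m <= n)%N -> bias thet eta n <= bias thet eta m.
Proof.
by move=> /bias_split ->; rewrite lerDr sumr_ge0// => k _; exact: sqr_ge0.
Qed.

Lemma sum_le_bias m n : \sum_(m <= k < n) delta2 k <= bias thet eta m.
Proof.
have [mn|nm] := leqP m n; first by rewrite (bias_split mn) lerDl bias_ge0.
by rewrite big_geq ?bias_ge0// ltnW.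
Qed.

Lemma bias_small (e : R) : 0 < e -> exists m, bias thet eta m < e.
Proof.
move=> e0; have := @is_cvg_tail 0 => /cvgrPdist_lt /(_ e e0) [N _ /(_ N (leqnn N))].
rewrite -/(bias thet eta 0) (bias_split (leq0n N)) addrAC subrr add0r.
by rewrite ger0_norm ?bias_ge0//; exists N.
Qed.

Lemma sqnorm_split (x : nat -> R) m :
  (forall k, (m <= k)%N -> x k = eta k - thet k) ->
  sqnorm x = (\sum_(0 <= k < m) x k ^+ 2 + bias thet eta m)%:E.
Proof.
move=> xE; rewrite /sqnorm (nneseries_split 0 m); last first.
  by move=> k _; rewrite lee_fin sqr_ge0.
rewrite add0n sumEFin EFinD; congr (_ + _)%E.
rewrite /bias -EFin_lim; last exact: is_cvg_tail.
congr (limn _); apply/funext => n /=; rewrite sumEFin; congr EFin.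
by apply: eq_big_nat => k /andP[mk _]; rewrite xE// -opprB sqrrN.
Qed.

End bias_theory.

Section Lam_theory.
Context (R : realType) (lam : nat -> R).
Hypothesis lam0 : forall k, lam k != 0.

Lemma Lam_gt0 k : 0 < Lam lam k.
Proof. by rewrite invr_gt0 exprn_even_gt0/=. Qed.

Lemma Lam_le_LamMax k m : (k < m)%N -> Lam lam k <= LamMax lam m.
Proof. by move=> km; exact: (le_bigmax _ (fun i : 'I_m => Lam lam i) (Ordinal km)). Qed.

Lemma LamMax_gt0 m : (0 < m)%N -> 0 < LamMax lam m.
Proof. by move=> m0; exact: lt_le_trans (Lam_gt0 0) (Lam_le_LamMax m0). Qed.

Lemma LamMax_le_bound m (B : R) : 0 <= B -> (forall k, (k < m)%N -> Lam lam k <= B) ->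
  LamMax lam m <= B.
Proof. by move=> B0 mB; apply: bigmax_le => // i _; exact: mB. Qed.

Lemma LamMax_mono m n : (m <= n)%N -> LamMax lam m <= LamMax lam n.
Proof.
move=> mn; apply: LamMax_le_bound => [|k km].
  case: n mn => [|n] _; first by rewrite /LamMax big_ord0.
  exact/ltW/LamMax_gt0.
exact: Lam_le_LamMax (leq_trans km mn).
Qed.

Lemma mulr_LamBar m : m%:R * LamBar lam m = \sum_(0 <= k < m) Lam lam k.
Proof.
rewrite /LamBar big_mkord; case: m => [|m]; first by rewrite big_ord0 mul0r.
by rewrite mulrC divfK// pnatr_eq0.
Qed.

Lemma LamBar_gt0 m : (0 < m)%N -> 0 < LamBar lam m.
Proof.
move=> m0; rewrite -(pmulr_rgt0 _ (_ : 0 < m%:R)) ?ltr0n// mulr_LamBar.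
rewrite big_ltn// ltr_pwDl ?Lam_gt0// sumr_ge0// => k _.
exact/ltW/Lam_gt0.
Qed.

Lemma LamBar_le_LamMax m : (0 < m)%N -> LamBar lam m <= LamMax lam m.
Proof.
move=> m0; rewrite -(ler_pM2l (_ : 0 < m%:R)) ?ltr0n// mulr_LamBar.
rewrite -[m in leRHS]subn0 mulr_natl -sumr_const_nat; apply: ler_sum_nat => k /andP[_ km].
by rewrite subn0; exact: Lam_le_LamMax.
Qed.

End Lam_theory.

Section oracle_dimension.
Context (R : realType) (lam thet eta : nat -> R).
Hypothesis ell2d : ell2 (fun k => thet k - eta k).
Hypothesis lam0 : forall k, lam k != 0.
Hypothesis bndlam : bounded_seq lam.

Lemma sum_Lam_unbounded (A : R) :
  exists N, forall m, (N <= m)%N -> A < \sum_(0 <= k < m) Lam lam k.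
Proof.
have [B hB] := bndlam.
have B0 : 0 < B by apply: lt_le_trans (hB 0%N); rewrite normr_gt0.
exists (Num.truncn (A * B ^+ 2)).+1 => m Nm.
have AB : A < m%:R * (B ^+ 2)^-1.
  rewrite ltr_pdivlMr ?exprn_gt0//.
  by apply: lt_le_trans (Num.Theory.truncnS_gt _) _; rewrite ler_nat.
apply: lt_le_trans AB _.
rewrite -[m in leLHS]subn0 mulr_natl -sumr_const_nat; apply: ler_sum_nat => k _.
have l0 : 0 < lam k ^+ 2 by rewrite exprn_even_gt0/=.
rewrite lef_pV2 ?posrE ?(exprn_gt0 2 B0)//.
by rewrite -[lam k ^+ 2]real_normK ?num_real// ler_sqr ?nnegrE ?(ltW B0).
Qed.

Lemma is_mo_mo (eps : R) : 0 < eps -> is_mo lam thet eta eps (mo lam thet eta eps).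
Proof.
move=> eps0; apply: xgetPex.
set F := Phi lam thet eta eps.
have [N hN] := sum_Lam_unbounded (F 1%N / eps).
pose i1 : 'I_N.+2 := Ordinal (isT : (1 < N.+2)%N).
pose im := [arg min_(i < i1 | (0 < i)%N) F i]%O.
have minF k : (1 <= k)%N -> F im <= F k.
  rewrite /im; case: Order.TotalTheory.arg_minP => //= i i0 imin k1.
  have [kN|Nk] := ltnP k N.+2; first exact: (imin (Ordinal kN)).
  apply: le_trans (imin i1 _) _ => //=.
  have := hN k (ltnW (ltnW Nk)).
  rewrite ltr_pdivrMr// -mulr_LamBar mulrC mulrA => /ltW F1k.
  by rewrite [leRHS]/F /Phi le_max F1k orbT.
have im0 : (0 < im)%N by rewrite /im; case: Order.TotalTheory.arg_minP.
pose Q m := (1 <= m)%N && `[< forall k, (1 <= k)%N -> F m <= F k >].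
have exQ : exists m, Q m by exists im; rewrite /Q im0; apply/asboolP.
case: (ex_minnP exQ) => m /andP[m1 /asboolP hm] mmin; exists m; split => //.
by move=> m' m'1 hm'; apply: mmin; rewrite /Q m'1; apply/asboolP.
Qed.

End oracle_dimension.

Lemma Geps_ge (R : realType) (lam : nat -> R) (eps : R) m : 0 < eps -> (1 <= m)%N ->
  m%:R <= eps^-1 -> eps * LamMax lam m <= Lam lam 0 -> (m <= Geps lam eps)%N.
Proof.
move=> eps0 m1 meps mLam.
have mt : (m < (Num.truncn eps^-1).+1)%N.
  by rewrite ltnS Num.Theory.truncn_ge_nat// invr_ge0 ltW.
apply: (@leq_bigmax_cond _ (fun i : 'I__ => (1 <= i)%N && (eps * LamMax lam i <= Lam lam 0))
  (fun i => nat_of_ord i) (Ordinal mt)).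
by rewrite /= m1.
Qed.

Section oracle_asymptotics.
Context (R : realType) (lam thet eta : nat -> R).
Hypothesis ell2d : ell2 (fun k => thet k - eta k).
Hypothesis lam0 : forall k, lam k != 0.
Hypothesis bndlam : bounded_seq lam.
Local Notation mo := (mo lam thet eta).
Local Notation Phio := (Phio lam thet eta).
Local Notation bias := (bias thet eta).

Lemma mo_gt0 eps : 0 < eps -> (0 < mo eps)%N.
Proof. by move=> /(is_mo_mo thet eta lam0 bndlam)[]. Qed.

Lemma Phio_le eps m : 0 < eps -> (1 <= m)%N -> Phio eps <= Phi lam thet eta eps m.
Proof. by move=> /(is_mo_mo thet eta lam0 bndlam)[_ h _]; exact: h. Qed.

Lemma bias_mo_le_Phio eps : bias (mo eps) <= Phio eps.
Proof. by rewrite /Phio /Phi le_max lexx. Qed.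

Lemma var_mo_le_Phio eps : eps * (mo eps)%:R * LamBar lam (mo eps) <= Phio eps.
Proof. by rewrite /Phio /Phi le_max lexx orbT. Qed.

Lemma Phio_gt0 eps : 0 < eps -> 0 < Phio eps.
Proof.
move=> eps0; apply: lt_le_trans (var_mo_le_Phio eps).
have LB := LamBar_gt0 lam0 (mo_gt0 eps0).
by apply: mulr_gt0 => //; apply: mulr_gt0 => //; rewrite ltr0n mo_gt0.
Qed.

Section kappa.
Variable eps_o : R.
Hypothesis eps_o1 : 0 < eps_o < 1.
Local Notation kappa := (kappao lam thet eta eps_o).

Lemma kappao_Phio_le eps : 0 < eps < eps_o ->
  kappa * Phio eps <= Num.min (bias (mo eps)) (eps * (mo eps)%:R * LamBar lam (mo eps)).
Proof.
move=> /andP[eps0 epso]; rewrite -ler_pdivlMr ?Phio_gt0// mulrC.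
apply: ge_inf; last by exists eps => //=; rewrite in_itv/= eps0.
exists 0 => _ [e /= + <-]; rewrite in_itv/= => /andP[e0 _].
rewrite mulr_ge0 ?invr_ge0 ?(ltW (Phio_gt0 e0))// le_min bias_ge0//=.
have LB := LamBar_gt0 lam0 (mo_gt0 e0).
by apply: mulr_ge0; [apply: mulr_ge0|]; rewrite ?ler0n ?ltW.
Qed.

Lemma kappao_le1 : kappa <= 1.
Proof.
case/andP: (eps_o1) => o0 o1.
have h : 0 < eps_o / 2 < eps_o by apply/andP; split; lra.
have h0 : 0 < eps_o / 2 by lra.
rewrite -(ler_pM2r (Phio_gt0 h0)) mul1r; apply: le_trans (kappao_Phio_le h) _.
by rewrite ge_min bias_mo_le_Phio.
Qed.

Lemma near_Phio_lt (e : R) : 0 < e -> \forall eps \near (0:R)^'+, Phio eps < e.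
Proof.
move=> e0; have [m hm] := bias_small ell2d e0.
set S := \sum_(0 <= k < m.+1) Lam lam k.
have S0 : 0 < S by rewrite /S -mulr_LamBar mulr_gt0 ?ltr0n// LamBar_gt0.
near=> eps.
have eps0 : 0 < eps by near: eps; exact: nbhs_right_gt.
apply: le_lt_trans (Phio_le eps0 (ltn0Sn m)) _.
rewrite /Phi gt_max (le_lt_trans _ hm) ?bias_le//=.
rewrite -mulrA mulr_LamBar -ltr_pdivlMr//.
by near: eps; apply: nbhs_right_lt; rewrite divr_gt0.
Unshelve. all: by end_near. Qed.

Hypothesis kappa0 : 0 < kappa.

Lemma near_mo_ge N : \forall eps \near (0:R)^'+, (N <= mo eps)%N.
Proof.
case/andP: (eps_o1) => o0 o1.
elim: N => [|N IH]; first by apply: nearW.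
have [bN|bN] := eqVneq (bias N) 0.
  near=> eps.
  have eps0 : 0 < eps by near: eps; exact: nbhs_right_gt.
  have epso : eps < eps_o by near: eps; exact: nbhs_right_lt.
  rewrite ltn_neqAle; apply/andP; split; last by near: eps.
  apply/eqP => NE.
  have : kappa * Phio eps <= bias (mo eps).
    have /kappao_Phio_le : 0 < eps < eps_o by rewrite eps0.
    by rewrite le_min => /andP[].
  by rewrite -NE bN leNgt mulr_gt0 ?Phio_gt0.
have {}bN : 0 < bias N by rewrite lt_def bN bias_ge0.
near=> eps.
rewrite ltn_neqAle; apply/andP; split; last by near: eps.
apply/eqP => NE; have := bias_mo_le_Phio eps; rewrite -NE leNgt => /negP; apply.
by near: eps; exact: near_Phio_lt.
Unshelve. all: by end_near. Qed.

Lemma near_mo_le_Geps (C L : R) : AssumptionE lam C L ->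
  \forall eps \near (0:R)^'+, (mo eps <= Geps lam eps)%N.
Proof.
move=> [_ L1 _ _ hL]; have L0 : 0 < L by lra.
have Lam00 := Lam_gt0 lam0 0.
near=> eps.
have eps0 : 0 < eps by near: eps; exact: nbhs_right_gt.
have m0 := mo_gt0 eps0; set m := mo eps.
have PhiL : Phio eps < Lam lam 0 / L.
  by near: eps; apply: near_Phio_lt; rewrite divr_gt0.
have {}PhiL : L * (eps * m%:R * LamBar lam m) <= Lam lam 0.
  by rewrite mulrC -ler_pdivlMr// (le_trans (var_mo_le_Phio eps))// ltW.
have LB := LamBar_gt0 lam0 m0.
have hLm : LamMax lam m <= L * LamBar lam m by rewrite -ler_pdivrMr// hL.
have m1 : 1 <= m%:R :> R by rewrite ler1n.
apply: Geps_ge => //.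
  rewrite -[leRHS]mul1r ler_pdivlMr//.
  rewrite -(ler_pM2r Lam00) mul1r; apply: le_trans PhiL.
  rewrite (_ : L * _ = m%:R * eps * (L * LamBar lam m)); last by ring.
  rewrite ler_pM2l ?mulr_gt0//; last by lra.
  by apply: le_trans hLm; exact: Lam_le_LamMax.
apply: le_trans PhiL.
rewrite (_ : L * _ = eps * (L * LamBar lam m) * m%:R); last by ring.
apply: (@le_trans _ _ (eps * (L * LamBar lam m))); first by rewrite ler_pM2l.
rewrite ler_peMr//; apply: mulr_ge0; first exact: ltW.
by apply: mulr_ge0; exact: ltW.
Unshelve. all: by end_near. Qed.

Lemma near_Geps_expR (C L c e : R) : AssumptionE lam C L ->
  (fun eps => ln (Geps lam eps)%:R / (mo eps)%:R : R) @ (0:R)^'+ --> (0:R) ->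
  0 < c -> 0 < e ->
  \forall eps \near (0:R)^'+, (Geps lam eps)%:R * expR (- (c * (mo eps)%:R)) < e.
Proof.
move=> hE /cvgr0Pnorm_lt hG c0 e0.
have c20 : 0 < c / 2 by rewrite divr_gt0.
near=> eps.
have eps0 : 0 < eps by near: eps; exact: nbhs_right_gt.
have m0 := mo_gt0 eps0.
have m0R : 0 < (mo eps)%:R :> R by rewrite ltr0n.
have moG : (mo eps <= Geps lam eps)%N by near: eps; exact: near_mo_le_Geps hE.
have G0 : 0 < (Geps lam eps)%:R :> R by rewrite ltr0n (leq_trans m0).
have lnG : ln (Geps lam eps)%:R / (mo eps)%:R < c / 2.
  by apply: le_lt_trans (ler_norm _) _; near: eps; exact: hG.
rewrite -[X in X * _]lnK ?posrE// -expRD.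
move: lnG; rewrite ltr_pdivrMr// => lnG.
have NE : (Num.truncn (e^-1 / (c / 2))).+1%:R <= (mo eps)%:R :> R.
  by rewrite ler_nat; near: eps; exact: near_mo_ge.
have big : e^-1 < c / 2 * (mo eps)%:R.
  rewrite mulrC -ltr_pdivrMr//.
  exact: lt_le_trans (Num.Theory.truncnS_gt _) NE.
apply: (@le_lt_trans _ _ (expR (- (c / 2 * (mo eps)%:R)))).
  by rewrite ler_expR; lra.
rewrite expRN -[ltRHS]invrK ltf_pV2 ?posrE ?invr_gt0 ?expR_gt0//.
apply: lt_le_trans big _; apply: le_trans (expR_ge1Dx _); lra.
Unshelve. all: by end_near. Qed.

End kappa.
End oracle_asymptotics.

(** * Parameters of the posterior *)

Section posterior_parameters.
Context (R : realType) (lam thet eta : nat -> R) (tau : R -> nat -> R) (eps : R).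
Hypothesis lam0 : forall k, lam k != 0.
Hypothesis eps01 : 0 < eps < 1.
Hypothesis tau0 : forall k, 0 < tau eps k.

Let eps0 : 0 < eps. Proof. by case/andP: eps01. Qed.

Definition shrinkage k := sig lam tau eps k * (lam k ^+ 2 / eps).
Definition snr k := lam k * (thet k - eta k) / Num.sqrt eps.

Local Notation a := shrinkage.

Let lam2_gt0 k : 0 < lam k ^+ 2.
Proof. by rewrite exprn_even_gt0/=. Qed.

Lemma sig_gt0 k : 0 < sig lam tau eps k.
Proof.
rewrite invr_gt0 addr_gt0 ?invr_gt0//.
by rewrite divr_gt0.
Qed.

Lemma shrinkage_gt0 k : 0 < a k.
Proof. by rewrite mulr_gt0 ?sig_gt0// divr_gt0. Qed.

Lemma shrinkageE k : a k = (1 + eps * Lam lam k / tau eps k)^-1.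
Proof.
rewrite /a /sig /Lam -[LHS]invrK; congr (_^-1).
have := lam2_gt0 k; have := tau0 k => t0 l0.
have h : lam k ^+ 2 * tau eps k + eps != 0 by rewrite gt_eqF// addr_gt0// mulr_gt0.
by field; rewrite lam0 h !gt_eqF.
Qed.

Lemma shrinkage_le1 k : a k <= 1.
Proof.
have u0 : 0 <= eps * Lam lam k / tau eps k.
  by rewrite ltW// divr_gt0// mulr_gt0// Lam_gt0.
by rewrite shrinkageE invf_le1; lra.
Qed.

Lemma sigE k : sig lam tau eps k = a k * (eps * Lam lam k).
Proof. by rewrite /a /Lam; field; rewrite lam0 gt_eqF. Qed.

Lemma sig_le k : sig lam tau eps k <= eps * Lam lam k.
Proof.
have eL0 : 0 < eps * Lam lam k by rewrite mulr_gt0// Lam_gt0.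
by rewrite sigE ler_piMl ?shrinkage_le1// ltW.
Qed.

Lemma shrinkage_snr k : a k * snr k ^+ 2 = a k * (thet k - eta k) ^+ 2 / (eps * Lam lam k).
Proof.
rewrite /snr expr_div_n exprMn sqr_sqrtr ?ltW// /Lam.
by field; rewrite lam0 gt_eqF.
Qed.

Lemma shrinkage_ge (d : R) k : 0 < d -> d * (eps * Lam lam k) <= tau eps k ->
  (1 + d^-1)^-1 <= a k.
Proof.
move=> d0 dt.
have eL0 : 0 < eps * Lam lam k by rewrite mulr_gt0// Lam_gt0.
have u0 : 0 < eps * Lam lam k / tau eps k by rewrite divr_gt0.
have d1 : 0 < d^-1 by rewrite invr_gt0.
rewrite shrinkageE lef_pV2 ?posrE ?addr_gt0//.
by rewrite lerD2l ler_pdivrMr// [leRHS]mulrC ler_pdivlMr// mulrC.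
Qed.

Lemma shrinkage_compl (d : R) k : 0 < d ->
  d * Num.sqrt (eps * Lam lam k) <= tau eps k ->
  (1 - a k) ^+ 2 <= eps * Lam lam k / d ^+ 2.
Proof.
move=> d0 dt.
have eL0 : 0 < eps * Lam lam k by rewrite mulr_gt0// Lam_gt0.
set u := eps * Lam lam k / tau eps k.
have u0 : 0 < u by rewrite divr_gt0.
have uE : 1 - a k = u / (1 + u).
  by rewrite shrinkageE -/u; field; rewrite gt_eqF ?addr_gt0.
have au : 1 - a k <= u by rewrite uE ler_pdivrMr ?addr_gt0//; nra.
have ud : u <= Num.sqrt (eps * Lam lam k) / d.
  rewrite ler_pdivrMr// mulrAC ler_pdivlMr// -[X in X * d](sqr_sqrtr (ltW eL0)).
  by rewrite expr2 -mulrA ler_wpM2l ?sqrtr_ge0// mulrC.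
apply: (@le_trans _ _ ((Num.sqrt (eps * Lam lam k) / d) ^+ 2)).
  by rewrite ler_sqr ?nnegrE ?(le_trans au)// ?subr_ge0 ?shrinkage_le1 ?divr_ge0 ?sqrtr_ge0 ?ltW.
by rewrite expr_div_n sqr_sqrtr// ltW.
Qed.

Section data.
Variables (y : nat -> R) (x : nat -> R).
Hypothesis yE : forall k, y k = lam k * thet k + Num.sqrt eps * x k.

Lemma thetaY_sub_eta k :
  thetaY lam tau eta eps y k - eta k =
  a k * ((thet k - eta k) + Num.sqrt eps / lam k * x k).
Proof.
have hs : sig lam tau eps k * (tau eps k)^-1 = 1 - a k.
  have s0 : lam k ^+ 2 / eps + (tau eps k)^-1 != 0.
    by rewrite gt_eqF// addr_gt0 ?invr_gt0// divr_gt0.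
  by apply/eqP; rewrite eq_sym subr_eq -mulrDr addrC mulVf.
rewrite /thetaY yE.
transitivity (sig lam tau eps k * (tau eps k)^-1 * eta k +
  sig lam tau eps k * (lam k / eps) * (lam k * thet k + Num.sqrt eps * x k) - eta k).
  by ring.
rewrite hs /a.
by field; rewrite lam0 gt_eqF.
Qed.

Lemma thetaY_sub_thet k :
  thetaY lam tau eta eps y k - thet k =
  - (1 - a k) * (thet k - eta k) + a k * (Num.sqrt eps / lam k) * x k.
Proof.
transitivity ((thetaY lam tau eta eps y k - eta k) - (thet k - eta k)); first by ring.
by rewrite thetaY_sub_eta; ring.
Qed.

Lemma nsig_term k :
  (thetaY lam tau eta eps y k - eta k) ^+ 2 / sig lam tau eps k =
  a k * (snr k + 1 * x k) ^+ 2.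
Proof.
have a0 := shrinkage_gt0 k.
have r0 : Num.sqrt eps != 0 by rewrite gt_eqF// sqrtr_gt0.
rewrite thetaY_sub_eta sigE /Lam /snr; move: a0; set b := a k => b0.
have := sqr_sqrtr (ltW eps0); move: r0; set r := Num.sqrt eps => r0 <-.
by field; rewrite lam0 r0 gt_eqF.
Qed.

Lemma nsigE m : nsig lam tau eta eps y m =
  \sum_(0 <= k < m) a k * (snr k + 1 * x k) ^+ 2.
Proof. by rewrite /nsig big_mkord; apply: eq_bigr => k _; exact: nsig_term. Qed.

Lemma nsig_sub m n : (m <= n)%N ->
  nsig lam tau eta eps y n - nsig lam tau eta eps y m =
  \sum_(m <= k < n) a k * (snr k + 1 * x k) ^+ 2.
Proof.
by move=> mn; rewrite !nsigE (big_cat_nat (leq0n m) mn)/= addrC addrK.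
Qed.

End data.
End posterior_parameters.

Section exponential_bounds.
Context (R : realType) (d : measure_display) (T : measurableType d).
Variable P : probability T R.

Lemma prob_le_expR (A : set T) (Z : T -> R) : measurable A ->
  measurable_fun setT Z -> (forall w, A w -> 0 <= Z w) ->
  (P A <= \int[P]_w (expR (Z w))%:E)%E.
Proof.
move=> mA mZ AZ; rewrite -[A in leLHS]setIT -integral_indic//.
apply: ge0_le_integral => //.
- by apply/measurable_EFinP; exact: measurable_indic.
- by apply/measurable_EFinP; apply: measurableT_comp.
- move=> w _; rewrite lee_fin indicE; have [Aw|_] := boolP (w \in A).
    by rewrite -expR0 ler_expR AZ// -in_setE.
  exact: expR_ge0.
Qed.

Variable xi : nat -> T -> R.
Hypothesis iidxi : iid_std_normal P xi.

Lemma measurable_sum_sq m n (t a b : nat -> R) : measurable_fun setT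
  (fun w => \sum_(m <= k < n) t k * (a k + b k * xi k w) ^+ 2).
Proof.
have [mxi _ _] := iidxi.
apply: measurable_sum => k; apply: measurable_funM => //.
by apply: measurable_funX; apply: measurable_funD => //; apply: measurable_funM.
Qed.

Lemma prob_sum_sq_gt n (t hi : R) (a b : nat -> R) : 0 <= t ->
  (forall k, (k < n)%N -> 4 * t * b k ^+ 2 <= 1) ->
  (P [set w | (hi < \sum_(0 <= k < n) (a k + b k * xi k w) ^+ 2)%R] <=
   (expR (- (t * hi) + \sum_(0 <= k < n) 2 * t * (a k ^+ 2 + b k ^+ 2)))%:E)%E.
Proof.
move=> t0 t1.
have mS : measurable_fun setT (fun w => \sum_(0 <= k < n) (a k + b k * xi k w) ^+ 2).
  have := measurable_sum_sq 0 n (fun=> 1) a b.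
  by under eq_fun do under eq_bigr do rewrite mul1r.
have mA : measurable [set w | hi < \sum_(0 <= k < n) (a k + b k * xi k w) ^+ 2].
  rewrite -[X in measurable X]setTI.
  by have := mS measurableT _ (measurable_itv `]hi, +oo[); rewrite preimage_itvoy.
apply: le_trans (@prob_le_expR _
  (fun w => - (t * hi) + \sum_(0 <= k < n) t * (a k + b k * xi k w) ^+ 2) mA _ _) _.
- by apply: measurable_funD => //; exact: (measurable_sum_sq 0 n (fun=> t) a b).
- by move=> w /= hiw; rewrite -mulr_sumr -mulrN -mulrDr mulr_ge0// addrC subr_ge0 ltW.
under eq_integral do rewrite expRD EFinM.
rewrite ge0_integralZl_EFin//; last first.
  apply/measurable_EFinP; apply: measurableT_comp => //.
  exact: (measurable_sum_sq 0 n (fun=> t) a b).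
rewrite expRD EFinM lee_pmul2l ?lte_fin ?expR_gt0//.
exact: (@expectation_exp_sum_up _ _ _ _ _ iidxi 0 n (fun=> t) a b (fun _ _ => t0) t1).
Qed.

Lemma prob_sum_sq_lt n (t lo : R) (a b : nat -> R) : 0 <= t ->
  (forall k, (k < n)%N -> 2 * t * b k ^+ 2 <= 1) ->
  (P [set w | (\sum_(0 <= k < n) (a k + b k * xi k w) ^+ 2 < lo)%R] <=
   (expR (t * lo - t * (\sum_(0 <= k < n) b k ^+ 2) / 2))%:E)%E.
Proof.
move=> t0 t1.
have mS : measurable_fun setT (fun w => \sum_(0 <= k < n) (a k + b k * xi k w) ^+ 2).
  have := measurable_sum_sq 0 n (fun=> 1) a b.
  by under eq_fun do under eq_bigr do rewrite mul1r.
have mA : measurable [set w | \sum_(0 <= k < n) (a k + b k * xi k w) ^+ 2 < lo].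
  rewrite -[X in measurable X]setTI.
  by have := mS measurableT _ (measurable_itv `]-oo, lo[); rewrite preimage_itvNyo.
apply: le_trans (@prob_le_expR _
  (fun w => t * lo - \sum_(0 <= k < n) t * (a k + b k * xi k w) ^+ 2) mA _ _) _.
- by apply: measurable_funB => //; exact: (measurable_sum_sq 0 n (fun=> t) a b).
- by move=> w /= wlo; rewrite -mulr_sumr -mulrBr mulr_ge0// subr_ge0 ltW.
under eq_integral do rewrite expRD EFinM.
rewrite ge0_integralZl_EFin//; last first.
  apply/measurable_EFinP; apply: measurableT_comp => //; apply: measurableT_comp => //.
  exact: (measurable_sum_sq 0 n (fun=> t) a b).
rewrite expRD EFinM lee_pmul2l ?lte_fin ?expR_gt0//.
apply: le_trans (@expectation_exp_sum_down _ _ _ _ _ iidxi 0 n (fun=> t) a b (fun _ _ => t0) t1) _.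
rewrite lee_fin ler_expR lerN2 ler_pM2r ?invr_gt0// mulr_sumr.
by apply: ler_sum => k _; rewrite ler_wpM2l// lerDr sqr_ge0.
Qed.

End exponential_bounds.

Section posterior_expectations.
Context (R : realType) (lam thet eta : nat -> R) (tau : R -> nat -> R) (eps C : R).
Context (d : measure_display) (T : measurableType d) (P : probability T R).
Context (xi : nat -> T -> R).
Hypothesis iidxi : iid_std_normal P xi.
Hypothesis lam0 : forall k, lam k != 0.
Hypothesis eps01 : 0 < eps < 1.
Hypothesis tau0 : forall k, 0 < tau eps k.

Definition logweight (y : nat -> R) m := nsig lam tau eta eps y m - 3 * C * m%:R.

Local Notation a := (shrinkage lam tau eps).
Local Notation snr := (snr lam thet eta eps).
Local Notation Y w := (fun k => lam k * thet k + Num.sqrt eps * xi k w).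

Lemma expectation_undersmooth m n : (m <= n)%N ->
  (\int[P]_w (expR ((logweight (Y w) m - logweight (Y w) n) / 2))%:E <=
   (expR (3 * C * (n%:R - m%:R) / 2 -
      (\sum_(m <= k < n) a k * snr k ^+ 2) / 4))%:E)%E.
Proof.
move=> mn.
have E w : (logweight (Y w) m - logweight (Y w) n) / 2 =
  3 * C * (n%:R - m%:R) / 2 +
    - \sum_(m <= k < n) a k / 2 * (snr k + 1 * xi k w) ^+ 2.
  rewrite (eq_bigr (fun k => a k * (snr k + 1 * xi k w) ^+ 2 / 2)); last first.
    by move=> k _; rewrite mulrAC.
  rewrite -mulr_suml -(nsig_sub eta lam0 eps01 tau0 (fun k => erefl) mn) /logweight.
  by field.
under eq_integral do rewrite E expRD EFinM.
rewrite ge0_integralZl_EFin//; last first.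
  apply/measurable_EFinP; apply: measurableT_comp => //; apply: measurableT_comp => //.
  exact: (measurable_sum_sq iidxi).
rewrite expRD EFinM lee_pmul2l ?lte_fin ?expR_gt0//.
apply: le_trans (@expectation_exp_sum_down _ _ _ _ _ iidxi m n
  (fun k => a k / 2) snr (fun=> 1) _ _) _ => [k _|k _|].
- by rewrite divr_ge0// ltW// shrinkage_gt0.
- by rewrite expr1n mulr1 mulrC divfK// shrinkage_le1.
rewrite lee_fin ler_expR lerN2.
have H : (\sum_(m <= k < n) a k * snr k ^+ 2) / 2 <=
    \sum_(m <= k < n) a k / 2 * (snr k ^+ 2 + 1 ^+ 2).
  rewrite mulr_suml; apply: ler_sum => k _.
  by have := shrinkage_gt0 lam0 eps01 tau0 k; lra.
by lra.
Qed.

Lemma expectation_oversmooth m n : (m <= n)%N ->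
  (\int[P]_w (expR ((logweight (Y w) n - logweight (Y w) m) / 4))%:E <=
   (expR (- (3 * C * (n%:R - m%:R) / 4) +
      (\sum_(m <= k < n) a k * (snr k ^+ 2 + 1)) / 2))%:E)%E.
Proof.
move=> mn.
have E w : (logweight (Y w) n - logweight (Y w) m) / 4 =
  - (3 * C * (n%:R - m%:R) / 4) +
    \sum_(m <= k < n) a k / 4 * (snr k + 1 * xi k w) ^+ 2.
  rewrite (eq_bigr (fun k => a k * (snr k + 1 * xi k w) ^+ 2 / 4)); last first.
    by move=> k _; rewrite mulrAC.
  rewrite -mulr_suml -(nsig_sub eta lam0 eps01 tau0 (fun k => erefl) mn) /logweight.
  by field.
under eq_integral do rewrite E expRD EFinM.
rewrite ge0_integralZl_EFin//; last first.
  apply/measurable_EFinP; apply: measurableT_comp => //.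
  exact: (measurable_sum_sq iidxi).
rewrite expRD EFinM lee_pmul2l ?lte_fin ?expR_gt0//.
apply: le_trans (@expectation_exp_sum_up _ _ _ _ _ iidxi m n
  (fun k => a k / 4) snr (fun=> 1) _ _) _ => [k _|k _|].
- by rewrite divr_ge0// ltW// shrinkage_gt0.
- by rewrite expr1n mulr1 mulrC divfK// shrinkage_le1.
rewrite lee_fin ler_expR mulr_suml; apply: ler_sum => k _.
by rewrite expr1n; lra.
Qed.

Local Notation A w := (fun k => thetaY lam tau eta eps (Y w) k - thet k).

Definition chernoff_bound t hi m w : R :=
  expR (- (t * hi) + \sum_(0 <= k < m) 2 * t * (A w k ^+ 2 + sig lam tau eps k)).

Let AE w k : A w k = - (1 - a k) * (thet k - eta k) + a k * (Num.sqrt eps / lam k) * xi k w.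
Proof. exact: (thetaY_sub_thet eta lam0 eps01 tau0 (fun k => erefl)). Qed.

Lemma measurable_chernoff_bound t hi m : measurable_fun setT (chernoff_bound t hi m).
Proof.
rewrite /chernoff_bound; apply: measurableT_comp => //; apply: measurable_funD => //.
under eq_fun do under eq_bigr do rewrite mulrDr AE.
under eq_fun do rewrite big_split/=.
apply: measurable_funD => //.
exact: (measurable_sum_sq iidxi 0 m (fun=> 2 * t)).
Qed.

Lemma expectation_chernoff_bound t hi m : 0 <= t ->
  (forall k, (k < m)%N -> 8 * t * (eps * Lam lam k) <= 1) ->
  (\int[P]_w (chernoff_bound t hi m w)%:E <=
   (expR (- (t * hi) + 6 * t * (\sum_(0 <= k < m) eps * Lam lam k) +
      4 * t * (\sum_(0 <= k < m) (1 - a k) ^+ 2 * (thet k - eta k) ^+ 2)))%:E)%E.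
Proof.
move=> t0 t1.
have E w : chernoff_bound t hi m w =
    expR (- (t * hi) + 2 * t * \sum_(0 <= k < m) sig lam tau eps k) *
    expR (\sum_(0 <= k < m) 2 * t *
      (- (1 - a k) * (thet k - eta k) + a k * (Num.sqrt eps / lam k) * xi k w) ^+ 2).
  rewrite -expRD -addrA; congr expR; congr (_ + _).
  rewrite mulr_sumr -big_split/=; apply: eq_bigr => k _.
  by rewrite AE; ring.
under eq_integral do rewrite E EFinM.
rewrite ge0_integralZl_EFin//; last first.
  apply/measurable_EFinP; apply: measurableT_comp => //.
  exact: (measurable_sum_sq iidxi).
case/andP: (eps01) => eps0 _.
have cE k : (a k * (Num.sqrt eps / lam k)) ^+ 2 = a k ^+ 2 * (eps * Lam lam k).
  by rewrite exprMn; congr (_ * _); rewrite expr_div_n (sqr_sqrtr (ltW eps0)).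
have a01 k : 0 <= a k ^+ 2 <= 1.
  by rewrite sqr_ge0 exprn_ile1// ?shrinkage_le1// ltW// shrinkage_gt0.
have eL0 k : 0 < eps * Lam lam k by rewrite mulr_gt0// Lam_gt0.
have c_le k : (a k * (Num.sqrt eps / lam k)) ^+ 2 <= eps * Lam lam k.
  by rewrite cE ler_piMl ?(ltW (eL0 k))//; case/andP: (a01 k).
apply: le_trans (lee_wpmul2l _ (@expectation_exp_sum_up _ _ _ _ _ iidxi 0 m
  (fun=> 2 * t) (fun k => - (1 - a k) * (thet k - eta k))
  (fun k => a k * (Num.sqrt eps / lam k)) _ _)) _.
- by rewrite lee_fin expR_ge0.
- by move=> k _; rewrite mulr_ge0.
- move=> k /andP[_ km]; apply: le_trans (t1 k km).
  rewrite (_ : 4 * (2 * t) = 8 * t); last by ring.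
  by rewrite ler_wpM2l// mulr_ge0.
rewrite -EFinM -expRD lee_fin ler_expR -!addrA lerD2l.
rewrite !mulr_sumr -!big_split/=; apply: ler_sum => k _.
have h1 : t * sig lam tau eps k <= t * (eps * Lam lam k).
  by rewrite ler_wpM2l// sig_le.
have h2 : t * (a k * (Num.sqrt eps / lam k)) ^+ 2 <= t * (eps * Lam lam k).
  by rewrite ler_wpM2l.
by rewrite [(- (1 - a k) * _) ^+ 2]exprMn sqrrN; lra.
Qed.

End posterior_expectations.

(** * Exponents of the Chernoff bounds *)

Section exponent_bounds.
Context (R : realType) (lam thet eta : nat -> R) (tau : R -> nat -> R).
Context (eps d C L kappa Phi : R) (m0 D G : nat).
Hypothesis ell2d : ell2 (fun k => thet k - eta k).
Hypothesis lam0 : forall k, lam k != 0.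
Hypothesis eps01 : 0 < eps < 1.
Hypothesis tau0 : forall k, 0 < tau eps k.
Hypothesis d0 : 0 < d.
Hypothesis tauA : forall k, (k < G)%N ->
  d * Num.max (Num.sqrt (eps * Lam lam k)) (eps * Lam lam k) <= tau eps k.
Hypothesis hE : AssumptionE lam C L.
Hypothesis kappa01 : 0 < kappa <= 1.
Hypothesis Phi0 : 0 < Phi.
Hypothesis m0_ge2 : (2 <= m0)%N.
Hypothesis m0_leG : (m0 <= G)%N.
Hypothesis biasPhi : bias thet eta m0 <= Phi.
Hypothesis varPhi : eps * m0%:R * LamBar lam m0 <= Phi.
Hypothesis Phi_bias : kappa * Phi <= bias thet eta m0.
Hypothesis Phi_var : kappa * Phi <= eps * m0%:R * LamBar lam m0.
Hypothesis D_ge : 5 * L / kappa <= D%:R.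

Local Notation a := (shrinkage lam tau eps).
Local Notation snr := (snr lam thet eta eps).
Local Notation bias := (bias thet eta).
Local Notation delta2 k := ((thet k - eta k) ^+ 2).
Local Notation p := (1 + d^-1).
Local Notation s := (eps * LamMax lam m0).
Local Notation A := (Num.max p (bias 0 / d ^+ 2)).
Local Notation B := (Num.max (8 * C * p) (D%:R * LamMax lam D)).
Local Notation K := (10 * A * L ^+ 2 * B).
Local Notation c := ((8 * L * p)^-1).

Let eps0 : 0 < eps. Proof. by case/andP: eps01. Qed.
Let C1 : 1 <= C. Proof. by case: hE. Qed.
Let L1 : 1 <= L. Proof. by case: hE. Qed.
Let p1 : 1 <= p. Proof. by rewrite lerDl invr_ge0 ltW. Qed.
Let m0_gt0 : (0 < m0)%N. Proof. exact: ltnW m0_ge2. Qed.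
Let M1 : 2 <= m0%:R :> R. Proof. by rewrite (ler_nat _ 2). Qed.
Let s0 : 0 < s. Proof. by rewrite mulr_gt0// (LamMax_gt0 lam0). Qed.

Let c_gt0 : 0 < c.
Proof. by rewrite invr_gt0 !mulr_gt0//; move: L1 p1; lra. Qed.

Let c_le : c <= 8^-1.
Proof.
rewrite lef_pV2 ?posrE ?(mulr_gt0 (mulr_gt0 _ _) _)//; move: L1 p1 => ? ?; try lra.
by nra.
Qed.

Let s_le_var : s * m0%:R <= L * (eps * m0%:R * LamBar lam m0).
Proof.
have [_ _ _ _ /(_ m0 m0_gt0) h] := hE.
move: h; rewrite ler_pdivrMr ?(LamBar_gt0 lam0)// => h.
rewrite [leRHS](_ : _ = eps * m0%:R * (L * LamBar lam m0)); last by ring.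
by rewrite mulrAC ler_wpM2l// mulr_ge0// ltW.
Qed.

Let s_le : s * m0%:R <= L * Phi.
Proof. by apply: le_trans s_le_var _; rewrite ler_wpM2l//; move: L1; lra. Qed.

Let var_le : eps * m0%:R * LamBar lam m0 <= s * m0%:R.
Proof.
rewrite [leRHS]mulrAC ler_wpM2l//; first by rewrite mulr_ge0// ltW.
exact: LamBar_le_LamMax.
Qed.

Let a_ge k : (k < G)%N -> p^-1 <= a k.
Proof.
move=> kG; apply: shrinkage_ge => //; apply: le_trans (tauA kG).
by rewrite ler_pM2l// le_max lexx orbT.
Qed.

Let compl_le k : (k < G)%N -> (1 - a k) ^+ 2 <= eps * Lam lam k / d ^+ 2.
Proof.
move=> kG; apply: shrinkage_compl => //; apply: le_trans (tauA kG).
by rewrite ler_pM2l// le_max lexx.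
Qed.

Let a_gt0 k : 0 < a k. Proof. exact: shrinkage_gt0. Qed.
Let a_le1 k : a k <= 1. Proof. exact: shrinkage_le1. Qed.
Let eLam_gt0 k : 0 < eps * Lam lam k. Proof. by rewrite mulr_gt0// Lam_gt0. Qed.

Lemma undersmooth_exponent m : (m < m0)%N -> 8 * L * C * p * Phi < bias m ->
  3 * C * (m0%:R - m%:R) / 2 - (\sum_(m <= k < m0) a k * snr k ^+ 2) / 4
    <= - (c * m0%:R).
Proof.
move=> mm0 hm.
have H1 : (\sum_(m <= k < m0) delta2 k) / (p * s) <= \sum_(m <= k < m0) a k * snr k ^+ 2.
  rewrite mulr_suml; apply: ler_sum_nat => k /andP[_ km].
  rewrite shrinkage_snr// [leRHS](_ : _ = delta2 k * (a k * (eps * Lam lam k)^-1)).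
    2: by ring.
  rewrite ler_wpM2l ?sqr_ge0// invfM.
  apply: ler_pM; rewrite ?invr_ge0 ?(ltW s0)//; first by move: p1; lra.
    by apply: a_ge; exact: leq_trans km m0_leG.
  rewrite lef_pV2 ?posrE ?eLam_gt0// ler_pM2l//.
  exact: Lam_le_LamMax.
have H2 : 7 * L * C * p * Phi <= \sum_(m <= k < m0) delta2 k.
  have := bias_split ell2d (ltnW mm0).
  have LCp : 1 <= L * C * p.
    by apply: mulr_ege1 => //; apply: mulr_ege1.
  have : Phi <= L * C * p * Phi by rewrite ler_peMl // ltW.
  by move: hm biasPhi; lra.
have H3 : 7 * C * m0%:R <= (\sum_(m <= k < m0) delta2 k) / (p * s).
  have p0 : 0 < p by move: p1; lra.
  rewrite ler_pdivlMr ?(mulr_gt0 p0 s0)//; apply: le_trans H2.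
  rewrite (_ : _ * (p * s) = 7 * C * p * (s * m0%:R)); last by ring.
  rewrite (_ : 7 * L * C * p * Phi = 7 * C * p * (L * Phi)); last by ring.
  by rewrite ler_wpM2l// !mulr_ge0//; move: C1 p0; lra.
have H4 : 0 <= C * m%:R by rewrite mulr_ge0//; move: C1; lra.
have H5 : c * m0%:R <= 8^-1 * m0%:R by rewrite ler_wpM2r.
have H6 : m0%:R <= C * m0%:R by rewrite ler_peMl.
by move: (le_trans H3 H1) M1; lra.
Qed.

Lemma oversmooth_exponent m : (D * m0 < m)%N ->
  - (3 * C * (m%:R - m0%:R) / 4) + (\sum_(m0 <= k < m) a k * (snr k ^+ 2 + 1)) / 2
    <= - (c * m0%:R).
Proof.
case/andP: kappa01 => k0 k1 Dm.
have kV : 1 <= kappa^-1 by rewrite invf_ge1.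
have DR : 5 * kappa^-1 <= D%:R.
  apply: le_trans D_ge; rewrite ler_wpM2r ?invr_ge0 ?(ltW k0)//; move: L1; lra.
have DmR : D%:R * m0%:R <= m%:R :> R by rewrite -natrM ler_nat ltnW.
have m5 : 5 * kappa^-1 * m0%:R <= m%:R by apply: le_trans DmR; rewrite ler_wpM2r.
have m0m : (m0 <= m)%N.
  rewrite -(ler_nat R); apply: le_trans m5; rewrite ler_peMl//; lra.
have H1 : \sum_(m0 <= k < m) a k * snr k ^+ 2 <= C * m0%:R * kappa^-1.
  apply: (@le_trans _ _ (C / s * Phi)); last first.
    rewrite -(ler_pM2r s0) [leLHS]mulrAC divfK ?(gt_eqF s0)//.
    rewrite (_ : _ * s = C * (kappa^-1 * (s * m0%:R))); last by ring.
    rewrite ler_wpM2l//; first by move: C1; lra.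
    rewrite mulrC ler_pdivlMr// mulrC.
    exact: le_trans Phi_var var_le.
  apply: (@le_trans _ _ (C / s * bias m0)); last first.
    by rewrite ler_wpM2l// divr_ge0 ?(ltW s0)//; move: C1; lra.
  apply: (@le_trans _ _ (C / s * \sum_(m0 <= k < m) delta2 k)); last first.
    rewrite ler_wpM2l ?sum_le_bias// divr_ge0 ?(ltW s0)//; move: C1; lra.
  rewrite mulr_sumr; apply: ler_sum_nat => k /andP[m0k _].
  rewrite shrinkage_snr// mulrAC ler_wpM2r ?sqr_ge0//.
  apply: (@le_trans _ _ (eps * Lam lam k)^-1).
    by rewrite ler_piMl// invr_ge0 ltW.
  have [_ _ /(_ m0 m0_gt0 k m0k) h _ _] := hE.
  rewrite !invfM /Lam invrK [leRHS]mulrCA ler_wpM2l ?invr_ge0 ?(ltW eps0)//.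
have H2 : \sum_(m0 <= k < m) a k <= m%:R - m0%:R.
  rewrite -natrB// -sumr_const_nat; apply: ler_sum_nat => k _; exact: a_le1.
have -> : \sum_(m0 <= k < m) a k * (snr k ^+ 2 + 1) =
    \sum_(m0 <= k < m) a k * snr k ^+ 2 + \sum_(m0 <= k < m) a k.
  by rewrite -big_split/=; apply: eq_bigr => k _; ring.
have H5 : c * m0%:R <= 8^-1 * m0%:R by rewrite ler_wpM2r.
have H6 : m0%:R <= C * m0%:R by rewrite ler_peMl.
have H7 : C * m0%:R <= C * m0%:R * kappa^-1.
  by rewrite ler_peMr// mulr_ge0//; move: C1; lra.
have H8 : 5 * (C * m0%:R * kappa^-1) <= C * m%:R.
  rewrite (_ : 5 * _ = C * (5 * kappa^-1 * m0%:R)); last by ring.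
  by rewrite ler_wpM2l//; move: C1; lra.
have H9 : m%:R - m0%:R <= C * (m%:R - m0%:R).
  by rewrite ler_peMl// subr_ge0 ler_nat.
by move: M1; lra.
Qed.

Let D_gt0 : (0 < D)%N.
Proof.
case/andP: kappa01 => k0 k1; rewrite -(ltr_nat R); apply: lt_le_trans D_ge.
by rewrite divr_gt0//; move: L1; lra.
Qed.

Let LamD1 : 1 <= LamMax lam D.
Proof.
have h1 : 1 <= LamMax lam 1.
  have [_ _ _ /(_ 1%N 1%N isT isT) h _] := hE; move: h.
  by rewrite muln1 ler_pMr ?(LamMax_gt0 lam0).
exact: le_trans h1 (LamMax_mono lam0 D_gt0).
Qed.

Let A1 : 1 <= A. Proof. by rewrite le_max p1. Qed.
Let pA : p <= A. Proof. by rewrite le_max lexx. Qed.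
Let B8 : 8 * C * p <= B. Proof. by rewrite le_max lexx. Qed.
Let BD : D%:R * LamMax lam D <= B. Proof. by rewrite le_max lexx orbT. Qed.
Let B0 : 0 < B.
Proof. by apply: lt_le_trans B8; rewrite !mulr_gt0//; move: C1 p1; lra. Qed.

Let K_gt0 : 0 < K.
Proof. by rewrite !mulr_gt0 ?exprn_gt0//; move: A1 L1; lra. Qed.

Let K_ge : 50 * p / kappa <= K.
Proof.
case/andP: kappa01 => k0 k1.
have kV : 1 <= kappa^-1 by rewrite invf_ge1.
have h1 : 5 / kappa <= B.
  apply: le_trans BD; apply: (@le_trans _ _ D%:R); last first.
    by rewrite ler_peMr.
  apply: le_trans D_ge; rewrite ler_wpM2r ?invr_ge0 ?(ltW k0)//; move: L1; lra.
have h2 : 1 <= L ^+ 2 by rewrite exprn_ege1.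
have h3 : p * (5 / kappa) <= A * L ^+ 2 * B.
  apply: ler_pM => //.
  - by move: p1; lra.
  - by rewrite divr_ge0 // ltW.
  - by apply: le_trans pA _; rewrite ler_peMr//; move: A1; lra.
by move: h3; lra.
Qed.

Lemma lower_level_le_bias m : (m <= m0)%N -> K^-1 * Phi <= bias m.
Proof.
case/andP: kappa01 => k0 k1 mm0.
apply: le_trans (bias_le ell2d mm0); apply: le_trans Phi_bias.
rewrite ler_pM2r// -[leRHS]invrK lef_pV2 ?posrE ?invr_gt0//.
apply: le_trans K_ge; rewrite -[leLHS]mul1r ler_wpM2r ?invr_ge0 ?(ltW k0)//.
by move: p1; lra.
Qed.

Lemma lower_rate k : (k < m0)%N -> 2 * (2 * s)^-1 * sig lam tau eps k <= 1.
Proof.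
move=> km; rewrite invfM mulrA mulfV// mul1r mulrC ler_pdivrMr// mul1r.
apply: le_trans (sig_le lam0 eps01 tau0 k) _; rewrite ler_pM2l//.
exact: Lam_le_LamMax.
Qed.

Lemma lower_exponent :
  (2 * s)^-1 * (K^-1 * Phi) -
    (2 * s)^-1 * (\sum_(0 <= k < m0) sig lam tau eps k) / 2 <= - (c * m0%:R).
Proof.
case/andP: kappa01 => k0 k1.
have p0 : 0 < p by move: p1; lra.
set V := eps * m0%:R * LamBar lam m0.
have HS : V / p <= \sum_(0 <= k < m0) sig lam tau eps k.
  have -> : V / p = p^-1 * eps * (m0%:R * LamBar lam m0) by rewrite /V; ring.
  rewrite mulr_LamBar mulr_sumr; apply: ler_sum_nat => k /andP[_ km].
  rewrite sigE// -mulrA ler_wpM2r ?(ltW (eLam_gt0 k))//.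
  by apply: a_ge; exact: leq_trans km m0_leG.
have HK : K^-1 * Phi <= (V / p) / 50.
  rewrite ler_pdivlMr// mulrC ler_pdivlMr//.
  rewrite mulrA mulrAC; apply: le_trans Phi_var.
  rewrite [leLHS](_ : _ = (50 * p * K^-1) * Phi); last by ring.
  rewrite ler_pM2r// ler_pdivrMr//.
  by have := K_ge; rewrite ler_pdivrMr// [leRHS]mulrC.
have Vs : c * m0%:R <= (8 * s)^-1 * (V / p).
  have L0 : 0 < L by move: L1; lra.
  have cE (x y l n : R) : 0 < x -> 0 < y -> 0 < l ->
      (8 * l * y)^-1 * n = (8 * x)^-1 * (x * n / l / y).
    by move=> x0 y0 l0; field; rewrite !gt_eqF.
  rewrite (cE s)//.
  have s8 : 0 < (8 * s)^-1 by rewrite invr_gt0 mulr_gt0.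
  rewrite ler_pM2l//.
  by rewrite ler_wpM2r ?invr_ge0 ?(ltW p0)// ler_pdivrMr// [leRHS]mulrC.
have Vp0 : 0 <= V / p.
  by apply: divr_ge0; rewrite ?(ltW p0)//; apply: le_trans Phi_var; rewrite mulr_ge0// ltW.
have i0 : 0 < s^-1 by rewrite invr_gt0.
move: Vs; rewrite !invfM.
have h1 : s^-1 * (K^-1 * Phi) <= s^-1 * ((V / p) / 50) by rewrite ler_pM2l.
have h2 : s^-1 * (V / p) <= s^-1 * \sum_(0 <= k < m0) sig lam tau eps k by rewrite ler_pM2l.
have h3 : 0 <= s^-1 * (V / p) by rewrite mulr_ge0// ltW.
by move: h1 h2 h3; rewrite -!invfM; lra.
Qed.

Local Notation s' := (LamMax lam D * s).

Let s'0 : 0 < s'. Proof. by rewrite mulr_gt0// LamMax_gt0. Qed.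

Let eLam_le_s' m k : (m <= D * m0)%N -> (k < m)%N -> eps * Lam lam k <= s'.
Proof.
move=> mD km; rewrite mulrCA ler_pM2l//.
apply: le_trans (Lam_le_LamMax lam km) _; apply: le_trans (LamMax_mono lam0 mD) _.
by have [_ _ _ h _] := hE; exact: h.
Qed.

Lemma upper_rate m k : (m <= D * m0)%N -> (k < m)%N ->
  8 * (8 * s')^-1 * (eps * Lam lam k) <= 1.
Proof.
have e (x y : R) : 8 * (8 * x)^-1 * y = y / x.
  by rewrite invfM mulrA mulfV// mul1r mulrC.
move=> mD km; rewrite e ler_pdivrMr// mul1r.
exact: eLam_le_s' km.
Qed.

Lemma upper_exponent m : (m <= D * m0)%N -> (m <= G)%N ->
  bias m <= 8 * L * C * p * Phi ->
  - ((8 * s')^-1 * (K * Phi - bias m)) +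
    6 * (8 * s')^-1 * (\sum_(0 <= k < m) eps * Lam lam k) +
    4 * (8 * s')^-1 * (\sum_(0 <= k < m) (1 - a k) ^+ 2 * delta2 k)
  <= - (c * m0%:R).
Proof.
move=> mD mG hb.
pose W := L * B * Phi.
have L0 : 0 < L by move: L1; lra.
have W0 : 0 < W by rewrite /W !mulr_gt0.
have s'W : LamMax lam D * (s * m0%:R) * D%:R <= W.
  rewrite /W (_ : L * B * Phi = B * (L * Phi)); last by ring.
  rewrite mulrAC; apply: ler_pM => //.
  - by rewrite mulr_ge0//; move: LamD1; lra.
  - by rewrite mulr_ge0// ltW.
  - by rewrite mulrC.
have s'm0 : s' * m0%:R <= W.
  apply: le_trans s'W; rewrite -mulrA ler_peMr ?ler1n//.
  have LD0 : 0 <= LamMax lam D by move: LamD1; lra.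
  by apply: mulr_ge0 => //; apply: mulr_ge0 => //; exact: ltW.
have h1 : bias m <= W.
  apply: le_trans hb _; rewrite (_ : 8 * L * C * p * Phi = 8 * C * p * (L * Phi)); last by ring.
  rewrite /W (_ : L * B * Phi = B * (L * Phi)); last by ring.
  by rewrite ler_wpM2r// mulr_ge0// ltW.
have h2 : \sum_(0 <= k < m) eps * Lam lam k <= W.
  apply: (@le_trans _ _ (\sum_(0 <= k < m) s')).
    by apply: ler_sum_nat => k /andP[_ km]; exact: eLam_le_s' km.
  rewrite sumr_const_nat subn0 -mulr_natr; apply: le_trans s'W.
  rewrite [leRHS](_ : _ = s' * (D * m0)%:R); last by rewrite natrM; ring.
  by rewrite ler_pM2l// ler_nat.
have h3 : \sum_(0 <= k < m) (1 - a k) ^+ 2 * delta2 k <= A * s'.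
  apply: (@le_trans _ _ (\sum_(0 <= k < m) s' / d ^+ 2 * delta2 k)).
    apply: ler_sum_nat => k /andP[_ km]; rewrite ler_wpM2r ?sqr_ge0//.
    apply: le_trans (compl_le _) _; first exact: leq_trans km mG.
    by rewrite ler_wpM2r ?invr_ge0 ?sqr_ge0//; exact: eLam_le_s' km.
  rewrite -mulr_sumr; apply: (@le_trans _ _ (s' / d ^+ 2 * bias 0)).
    by rewrite ler_wpM2l ?sum_le_bias// divr_ge0 ?sqr_ge0// ltW.
  rewrite mulrAC -mulrA mulrC ler_pM2r//.
  by rewrite le_max lexx orbT.
have AW : A * s' * 2 <= A * W.
  rewrite -mulrA ler_pM2l//; last by move: A1; lra.
  by apply: le_trans s'm0; rewrite ler_pM2l.
have WA : W <= A * W by rewrite ler_peMl// ltW.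
have KW : 10 * (A * W) <= K * Phi.
  rewrite /W (_ : K * Phi = L * (10 * (A * (L * B * Phi)))); last by ring.
  by rewrite ler_peMl// !mulr_ge0 ?ltW//; move: A1; lra.
have tW : 8^-1 * m0%:R <= (8 * s')^-1 * W.
  by rewrite invfM -mulrA ler_pM2l// mulrC ler_pdivlMr// mulrC.
have H5 : c * m0%:R <= 8^-1 * m0%:R by rewrite ler_wpM2r.
have t0 : 0 < (8 * s')^-1 by rewrite invr_gt0 mulr_gt0.
set t := (8 * s')^-1 in tW t0 *.
set S1 := \sum_(0 <= k < m) _ in h2 *; set S2 := \sum_(0 <= k < m) _ in h3 *.
have : t * (- (K * Phi - bias m) + 6 * S1 + 4 * S2 + W) <= 0.
  by rewrite pmulr_rle0//; move: h1 h2 h3 AW WA KW; lra.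
by move: H5 tW; lra.
Qed.

End exponent_bounds.

(** * Concentration of the hierarchical posterior *)

Section integral_monotone.
Context (R : realType) (d : measure_display) (T : measurableType d).
Import HBNNSimple.

(* No measurability is required here because the integral of a nonnegative
   function is a supremum over simple functions below it. *)
Lemma ge0_le_integralT (mu : {measure set T -> \bar R}) (f g : T -> \bar R) :
  (forall x, 0 <= f x)%E -> (forall x, f x <= g x)%E ->
  (\int[mu]_x f x <= \int[mu]_x g x)%E.
Proof.
move=> f0 fg; have g0 x : (0 <= g x)%E by exact: le_trans (f0 x) (fg x).
rewrite !ge0_integralTE//; apply: ereal_sup_le => _ [h hf <-].
exists h => // x.
exact: le_trans (hf x) (fg x).
Qed.

Lemma integral_ge_one_sub (P : probability T R) (f : T -> \bar R) (g : T -> R) (b : R) :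
  measurable_fun setT g -> (forall w, 0 <= g w) ->
  (\int[P]_w (g w)%:E <= b%:E)%E ->
  (forall w, 0 <= f w)%E -> (forall w, (1 - g w)%:E <= f w)%E ->
  ((1 - b)%:E <= \int[P]_w f w)%E.
Proof.
move=> mg g0 gb f0 fg.
pose h w := Num.max 0 (1 - g w).
have mh : measurable_fun setT h.
  by apply: measurable_maxr => //; exact: measurable_funB.
have h0 w : 0 <= h w by rewrite le_max lexx.
apply: (@le_trans _ _ (\int[P]_w (h w)%:E)%E); last first.
  apply: ge0_le_integralT => w; first by rewrite lee_fin.
  by rewrite /h; case: (leP 0 (1 - g w)).
have : (1%:E <= \int[P]_w (h w)%:E + \int[P]_w (g w)%:E)%E.
  rewrite -ge0_integralD//; last 4 first.
  - by move=> w _; rewrite lee_fin.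
  - exact/measurable_EFinP.
  - by move=> w _; rewrite lee_fin.
  - exact/measurable_EFinP.
  have <- : (\int[P]_w (cst 1%E w) = 1%:E)%E.
    by rewrite integral_cst// mul1e; exact: probability_setT.
  apply: ge0_le_integralT => w; first by rewrite lee_fin ler01.
  by rewrite -EFinD lee_fin -lerBlDr le_max lexx orbT.
rewrite EFinB leeBlDr//; move=> /le_trans; apply.
by rewrite leeD2l.
Qed.

End integral_monotone.

Section posterior_weights.
Context (R : realType) (lam eta : nat -> R) (tau : R -> nat -> R) (C eps : R).
Context (y : nat -> R).
Local Notation G := (Geps lam eps).
Local Notation S := (logweight lam eta tau eps C y).
Local Notation pM := (postM lam tau eta C eps y).

Let total m0 : (1 <= m0 <= G)%N ->
  expR (S m0 / 2) <= \sum_(1 <= k < G.+1) expR (S k / 2).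
Proof.
move=> m0G; rewrite (bigD1_seq m0) ?iota_uniq ?mem_index_iota//=.
by rewrite lerDl sumr_ge0// => k _; exact: expR_ge0.
Qed.

Let total_gt0 : (1 <= G)%N -> 0 < \sum_(1 <= k < G.+1) expR (S k / 2).
Proof. by move=> G1; apply: lt_le_trans (total (m0 := 1) _); rewrite ?expR_gt0 ?G1. Qed.

Lemma postM_ge0 m : 0 <= pM m.
Proof. by rewrite divr_ge0 ?expR_ge0// sumr_ge0// => k _; exact: expR_ge0. Qed.

Lemma sum_postM : (1 <= G)%N -> \sum_(1 <= m < G.+1) pM m = 1.
Proof. by move=> G1; rewrite -mulr_suml mulfV// gt_eqF// total_gt0. Qed.

Lemma postM_le_expR m m0 : (1 <= m0 <= G)%N -> pM m <= expR ((S m - S m0) / 2).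
Proof.
move=> m0G; rewrite mulrBl expRD expRN ler_wpM2l ?expR_ge0//.
by rewrite lef_pV2 ?posrE ?expR_gt0 ?total// (lt_le_trans (expR_gt0 _) (total m0G)).
Qed.

Lemma postM_le1 m : (1 <= m <= G)%N -> pM m <= 1.
Proof. by move=> mG; have := postM_le_expR m mG; rewrite subrr mul0r expR0. Qed.

Lemma postM_le_expR4 m m0 : (1 <= m <= G)%N -> (1 <= m0 <= G)%N ->
  pM m <= expR ((S m - S m0) / 4).
Proof.
move=> mG m0G; have [S0|S0] := leP 0 (S m - S m0).
  apply: le_trans (postM_le1 mG) _; rewrite -[leLHS]expR0 ler_expR.
  by rewrite divr_ge0.
by apply: le_trans (postM_le_expR m m0G) _; rewrite ler_expR; lra.
Qed.

End posterior_weights.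

Section good_event.
Context (R : realType) (lam thet eta : nat -> R) (tau : R -> nat -> R) (eps : R).
Context (d : measure_display) (T : measurableType d) (Q : probability T R).
Context (zeta : nat -> T -> R).
Hypothesis iidzeta : iid_std_normal Q zeta.
Hypothesis ell2d : ell2 (fun k => thet k - eta k).
Variables (y : nat -> R) (m : nat).

Local Notation A k := (thetaY lam tau eta eps y k - thet k).
Local Notation r k := (Num.sqrt (sig lam tau eps k)).
Local Notation vth w k := (if (k < m)%N then
  thetaY lam tau eta eps y k + Num.sqrt (sig lam tau eps k) * zeta k w else eta k).

Lemma sqnorm_posterior_draw w :
  sqnorm (fun k => vth w k - thet k) =
  (\sum_(0 <= k < m) (A k + r k * zeta k w) ^+ 2 + bias thet eta m)%:E.
Proof.
rewrite (@sqnorm_split _ thet eta ell2d _ m); last first.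
  by move=> k mk; rewrite ltnNge mk.
congr (_ + _)%:E; apply: eq_big_nat => k /andP[_ km].
by rewrite km addrAC.
Qed.

Local Notation head2 w := (\sum_(0 <= k < m) (A k + r k * zeta k w) ^+ 2).
Local Notation good lo hi := [set w | (lo%:E <= sqnorm (fun k => (vth w k - thet k)%R))%E
  && (sqnorm (fun k => (vth w k - thet k)%R) <= hi%:E)%E].

Let bad lo hi := [set w | hi - bias thet eta m < head2 w] `|`
                 [set w | head2 w < lo - bias thet eta m].

Let goodE lo hi : good lo hi = ~` bad lo hi.
Proof.
apply/seteqP; split => w; rewrite /bad /= sqnorm_posterior_draw !lee_fin.
  by move=> /andP[h1 h2] [|]; lra.
by move=> /not_orP[/negP h1 /negP h2]; apply/andP; split; lra.
Qed.

Let measurable_head2 : measurable_fun setT (fun w => head2 w).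
Proof.
have := measurable_sum_sq iidzeta 0 m (fun=> 1) (fun k => A k) (fun k => r k).
by under eq_fun do under eq_bigr do rewrite mul1r.
Qed.

Let measurable_head2_gt b : measurable [set w | b < head2 w].
Proof.
rewrite -[X in measurable X]setTI.
by have := measurable_head2 measurableT (measurable_itv `]b, +oo[); rewrite preimage_itvoy.
Qed.

Let measurable_head2_lt b : measurable [set w | head2 w < b].
Proof.
rewrite -[X in measurable X]setTI.
by have := measurable_head2 measurableT (measurable_itv `]-oo, b[); rewrite preimage_itvNyo.
Qed.

Lemma measurable_posterior_event lo hi : measurable (good lo hi).
Proof. by rewrite goodE; apply: measurableC; exact: measurableU. Qed.

Lemma posterior_prob_ge lo hi u v :
  (Q [set w | (hi - bias thet eta m < head2 w)%R] <= u%:E)%E ->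
  (Q [set w | (head2 w < lo - bias thet eta m)%R] <= v%:E)%E ->
  ((1 - (u + v))%:E <= Q (good lo hi))%E.
Proof.
move=> hu hv; rewrite goodE probability_setC; last exact: measurableU.
rewrite EFinB leeB// EFinD; apply: le_trans (measureU2 _ _ _) _ => //.
exact: leeD.
Qed.

End good_event.

Section posterior_concentration.
Context (R : realType) (lam thet eta : nat -> R) (tau : R -> nat -> R).
Context (eps d C L kappa Phi : R) (m0 D : nat).
Context (dP : measure_display) (T : measurableType dP) (P : probability T R).
Context (xi : nat -> T -> R).
Context (dQ : measure_display) (T' : measurableType dQ) (Q : probability T' R).
Context (zeta : nat -> T' -> R).
Local Notation G := (Geps lam eps).
Hypothesis iidxi : iid_std_normal P xi.
Hypothesis iidzeta : iid_std_normal Q zeta.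
Hypothesis ell2d : ell2 (fun k => thet k - eta k).
Hypothesis lam0 : forall k, lam k != 0.
Hypothesis eps01 : 0 < eps < 1.
Hypothesis tau0 : forall k, 0 < tau eps k.
Hypothesis d0 : 0 < d.
Hypothesis tauA : forall k, (k < G)%N ->
  d * Num.max (Num.sqrt (eps * Lam lam k)) (eps * Lam lam k) <= tau eps k.
Hypothesis hE : AssumptionE lam C L.
Hypothesis kappa01 : 0 < kappa <= 1.
Hypothesis Phi0 : 0 < Phi.
Hypothesis m0_ge2 : (2 <= m0)%N.
Hypothesis m0_leG : (m0 <= G)%N.
Hypothesis biasPhi : bias thet eta m0 <= Phi.
Hypothesis varPhi : eps * m0%:R * LamBar lam m0 <= Phi.
Hypothesis Phi_bias : kappa * Phi <= bias thet eta m0.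
Hypothesis Phi_var : kappa * Phi <= eps * m0%:R * LamBar lam m0.
Hypothesis D_ge : 5 * L / kappa <= D%:R.

Local Notation bias := (bias thet eta).
Local Notation p := (1 + d^-1).
Local Notation s := (eps * LamMax lam m0).
Local Notation K := (10 * Num.max p (bias 0 / d ^+ 2) * L ^+ 2 *
  Num.max (8 * C * p) (D%:R * LamMax lam D)).
Local Notation c := ((8 * L * p)^-1).
Local Notation Y w := (fun k => lam k * thet k + Num.sqrt eps * xi k w).
Local Notation S w m := (logweight lam eta tau eps C (Y w) m).
Local Notation pM w m := (postM lam tau eta C eps (Y w) m).
Local Notation t := ((8 * (LamMax lam D * s))^-1).
Local Notation vth m y w' k := (if (k < m)%N then
  thetaY lam tau eta eps y k + Num.sqrt (sig lam tau eps k) * zeta k w' else eta k).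
Local Notation good w m := [set w' |
  ((K^-1 * Phi)%:E <= sqnorm (fun k => (vth m (Y w) w' k - thet k)%R))%E
  && (sqnorm (fun k => (vth m (Y w) w' k - thet k)%R) <= (K * Phi)%:E)%E].

(* Bounds the part of the posterior mass of dimension m that misses the good event;
   unlike that mass, it is an explicit measurable function of the data. *)
Definition deficit m w : R :=
  if (m < m0)%N && (8 * L * C * p * Phi < bias m) then expR ((S w m - S w m0) / 2)
  else if (D * m0 < m)%N then expR ((S w m - S w m0) / 4)
  else chernoff_bound lam thet eta tau eps xi t (K * Phi - bias m) m w +
       expR (- (c * m0%:R)).

Let m0_gt0 : (0 < m0)%N. Proof. exact: ltnW m0_ge2. Qed.
Let m0G : (1 <= m0 <= G)%N. Proof. by rewrite m0_gt0. Qed.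
Let G1 : (1 <= G)%N. Proof. exact: leq_trans m0_leG. Qed.
Let eps0 : 0 < eps. Proof. by case/andP: eps01. Qed.
Let C1 : 1 <= C. Proof. by case: hE. Qed.
Let L1 : 1 <= L. Proof. by case: hE. Qed.
Let p1 : 1 <= p. Proof. by rewrite lerDl invr_ge0 ltW. Qed.
Let s0 : 0 < s. Proof. by rewrite mulr_gt0// (LamMax_gt0 lam0). Qed.
Let D0 : (0 < D)%N.
Proof.
case/andP: kappa01 => k0 k1; rewrite -(ltr_nat R); apply: lt_le_trans D_ge.
by rewrite divr_gt0//; move: L1; lra.
Qed.
Let s'0 : 0 < LamMax lam D * s. Proof. by rewrite mulr_gt0// (LamMax_gt0 lam0). Qed.
Let t0 : 0 <= t. Proof. by rewrite invr_ge0 ltW// mulr_gt0. Qed.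

Let measurable_S m : measurable_fun setT (fun w => S w m).
Proof.
rewrite /logweight; apply: measurable_funB => //.
under eq_fun do rewrite (nsigE eta lam0 eps01 tau0 (fun k => erefl)).
exact: (measurable_sum_sq iidxi 0 m (shrinkage lam tau eps)).
Qed.

Lemma measurable_deficit m : measurable_fun setT (deficit m).
Proof.
rewrite /deficit; case: (_ && _).
  apply: measurableT_comp => //; apply: measurable_funM => //.
  by apply: measurable_funB.
case: (D * m0 < m)%N.
  apply: measurableT_comp => //; apply: measurable_funM => //.
  by apply: measurable_funB.
apply: measurable_funD => //.
exact: (measurable_chernoff_bound thet eta iidxi lam0 eps01 tau0).
Qed.

Lemma deficit_ge0 m w : 0 <= deficit m w.
Proof.
rewrite /deficit; case: ifP => _; first exact: expR_ge0.
by case: ifP => _; rewrite ?addr_ge0 ?expR_ge0.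
Qed.

Let bias_small_of m : ((m < m0)%N && (8 * L * C * p * Phi < bias m)) = false ->
  bias m <= 8 * L * C * p * Phi.
Proof.
move=> /negbT; rewrite negb_and -leqNgt -leNgt => /orP[mm|//].
apply: le_trans (bias_le ell2d mm) _; apply: le_trans biasPhi _.
rewrite ler_peMl// ?ltW//.
have LCp : 1 <= L * C * p by apply: mulr_ege1 => //; apply: mulr_ege1.
by move: LCp; lra.
Qed.

Lemma expectation_deficit m : (m <= G)%N ->
  (\int[P]_w (deficit m w)%:E <= (2 * expR (- (c * m0%:R)))%:E)%E.
Proof.
move=> mG; rewrite /deficit.
case hm: ((m < m0)%N && (8 * L * C * p * Phi < bias m)).
  have /andP[mm0 hb] := hm.
  apply: le_trans (expectation_undersmooth thet eta C iidxi lam0 eps01 tau0 (ltnW mm0)) _.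
  rewrite lee_fin; apply: (@le_trans _ _ (expR (- (c * m0%:R)))).
    by rewrite ler_expR; apply: (@undersmooth_exponent _ _ _ _ _ _ _ _ _ Phi _ G).
  by rewrite ler_peMl ?expR_ge0// ler1n.
case Dm: (D * m0 < m)%N.
  have m0m : (m0 <= m)%N by apply: leq_trans (ltnW Dm); rewrite leq_pmull.
  apply: le_trans (expectation_oversmooth thet eta C iidxi lam0 eps01 tau0 m0m) _.
  rewrite lee_fin; apply: (@le_trans _ _ (expR (- (c * m0%:R)))).
    rewrite ler_expR.
    exact: (@oversmooth_exponent _ _ _ _ _ _ _ _ _ kappa Phi _ D).
  by rewrite ler_peMl ?expR_ge0// ler1n.
move/negbT: Dm; rewrite -leqNgt => mD.
have mch := measurable_chernoff_bound thet eta iidxi lam0 eps01 tau0 t (K * Phi - bias m) m.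
under eq_integral do rewrite EFinD.
rewrite ge0_integralD//; last 2 first.
- by move=> w _; rewrite lee_fin expR_ge0.
- exact/measurable_EFinP.
rewrite (_ : 2 * expR _ = expR (- (c * m0%:R)) + expR (- (c * m0%:R))); last by ring.
rewrite EFinD; apply: leeD.
  apply: le_trans (expectation_chernoff_bound thet eta iidxi lam0 eps01 tau0 _ t0 _) _.
    by move=> k km; exact: (upper_rate lam0 eps01 hE kappa01 m0_ge2 D_ge mD km).
  rewrite lee_fin ler_expR.
  apply: (upper_exponent ell2d lam0 eps01 tau0 d0 tauA hE kappa01 Phi0 m0_ge2
    varPhi D_ge mD mG).
  exact: bias_small_of.
rewrite integral_cst// -[leRHS]mule1 lee_pmul2l ?lte_fin ?expR_gt0//.
by rewrite le_eqVlt; apply/orP; left; apply/eqP; exact: probability_setT.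
Qed.

Let measurable_partial_sum y m : measurable_fun setT (fun w' =>
  \sum_(0 <= k < m) (thetaY lam tau eta eps y k - thet k +
     Num.sqrt (sig lam tau eps k) * zeta k w') ^+ 2).
Proof.
have := measurable_sum_sq iidzeta 0 m (fun=> 1)
  (fun k => thetaY lam tau eta eps y k - thet k) (fun k => Num.sqrt (sig lam tau eps k)).
by under eq_fun do under eq_bigr do rewrite mul1r.
Qed.

Let sqr_sqrt_sig k : Num.sqrt (sig lam tau eps k) ^+ 2 = sig lam tau eps k.
Proof. by rewrite sqr_sqrtr// ltW// sig_gt0. Qed.

Let prob_above m w : (m <= D * m0)%N ->
  (Q [set w' | (K * Phi - bias m < \sum_(0 <= k < m)
      (thetaY lam tau eta eps (Y w) k - thet k +
       Num.sqrt (sig lam tau eps k) * zeta k w') ^+ 2)%R] <=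
   (chernoff_bound lam thet eta tau eps xi t (K * Phi - bias m) m w)%:E)%E.
Proof.
move=> mD.
apply: le_trans (@prob_sum_sq_gt _ _ _ _ _ iidzeta m t _ _ _ t0 _) _ => [k km|].
  rewrite sqr_sqrt_sig.
  apply: le_trans (upper_rate lam0 eps01 hE kappa01 m0_ge2 D_ge mD km).
  have h1 : t * sig lam tau eps k <= t * (eps * Lam lam k).
    by rewrite ler_wpM2l// sig_le.
  have h2 : 0 <= t * sig lam tau eps k by rewrite mulr_ge0// ltW// sig_gt0.
  by move: h1 h2; lra.
rewrite lee_fin /chernoff_bound ler_expR lerD2l; apply: ler_sum => k _.
by rewrite sqr_sqrt_sig.
Qed.

Let prob_below m w :
  (Q [set w' | (\sum_(0 <= k < m)
      (thetaY lam tau eta eps (Y w) k - thet k +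
       Num.sqrt (sig lam tau eps k) * zeta k w') ^+ 2 < K^-1 * Phi - bias m)%R] <=
   (expR (- (c * m0%:R)))%:E)%E.
Proof.
have sq_ge0 a b y : 0 <= \sum_(a <= k < b) (thetaY lam tau eta eps (Y w) k - thet k +
       Num.sqrt (sig lam tau eps k) * zeta k y) ^+ 2.
  by rewrite sumr_ge0// => k _; exact: sqr_ge0.
have [mm0|m0m] := leqP m m0.
  have lb := lower_level_le_bias ell2d lam0 d0 hE kappa01 Phi0 Phi_bias D_ge mm0.
  rewrite (_ : [set w' | _] = set0) ?measure0 ?lee_fin ?expR_ge0//.
  rewrite -subset0 => w' /=; have := sq_ge0 0%N m w'.
  by move: lb; lra.
have mlt b n : measurable [set w' | \sum_(0 <= k < n)
    (thetaY lam tau eta eps (Y w) k - thet k +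
       Num.sqrt (sig lam tau eps k) * zeta k w') ^+ 2 < b].
  rewrite -[X in measurable X]setTI.
  have := measurable_partial_sum (Y w) n measurableT (measurable_itv `]-oo, b[).
  by rewrite preimage_itvNyo.
apply: (@le_trans _ _ (Q [set w' | (\sum_(0 <= k < m0)
    (thetaY lam tau eta eps (Y w) k - thet k +
       Num.sqrt (sig lam tau eps k) * zeta k w') ^+ 2 < K^-1 * Phi)%R])).
  apply: le_measure; rewrite ?inE//; try exact: mlt.
  move=> w' /=; rewrite (big_cat_nat (leq0n m0) (ltnW m0m))/=.
  have := sq_ge0 m0 m w'; have := bias_ge0 ell2d m.
  by lra.
have s2 : 0 <= (2 * s)^-1 by rewrite invr_ge0 ltW// mulr_gt0.
apply: le_trans (@prob_sum_sq_lt _ _ _ _ _ iidzeta m0 (2 * s)^-1 _ _ _ s2 _) _ => [k km|].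
  rewrite sqr_sqrt_sig.
  exact: (lower_rate lam0 eps01 tau0 m0_ge2 km).
rewrite lee_fin ler_expR.
under eq_bigr do rewrite sqr_sqrt_sig.
exact: (lower_exponent thet eta lam0 eps01 tau0 d0 tauA hE kappa01 Phi0 m0_ge2 m0_leG
  Phi_var D_ge).
Qed.

Lemma posterior_mass_deficit m w : (1 <= m <= G)%N ->
  ((pM w m - deficit m w)%:E <= (pM w m)%:E * Q (good w m))%E.
Proof.
move=> mG; have pM0 : 0 <= pM w m by exact: postM_ge0.
have pM1 : pM w m <= 1 by exact: postM_le1.
have RHS0 : (0 <= (pM w m)%:E * Q (good w m))%E by rewrite mule_ge0 ?lee_fin.
rewrite /deficit.
case hm: ((m < m0)%N && (8 * L * C * p * Phi < bias m)).
  apply: le_trans RHS0; rewrite lee_fin subr_le0.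
  exact: postM_le_expR.
case Dm: (D * m0 < m)%N.
  apply: le_trans RHS0; rewrite lee_fin subr_le0.
  exact: postM_le_expR4.
move/negbT: Dm; rewrite -leqNgt => mD.
have := posterior_prob_ge iidzeta ell2d (prob_above w mD) (prob_below m w).
set u := chernoff_bound _ _ _ _ _ _ _ _ _ _; set v := expR _ => hQ.
apply: (@le_trans _ _ ((pM w m)%:E * (1 - (u + v))%:E)%E).
  rewrite -EFinM lee_fin mulrBr mulr1 lerD2l lerN2.
  by rewrite ler_piMl// addr_ge0 ?expR_ge0.
by apply: lee_wpmul2l => //; rewrite lee_fin.
Qed.

Lemma integral_posterior_ge :
  ((1 - G%:R * (2 * expR (- (c * m0%:R))))%:E <=
   \int[P]_w \sum_(1 <= m < G.+1) (pM w m)%:E * Q (good w m))%E.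
Proof.
apply: (@integral_ge_one_sub _ _ _ _ _ (fun w => \sum_(1 <= m < G.+1) deficit m w)).
- by apply: measurable_sum => m; exact: measurable_deficit.
- by move=> w; apply: sumr_ge0 => m _; exact: deficit_ge0.
- under eq_integral do rewrite -sumEFin.
  rewrite ge0_integral_sum//; last 2 first.
  + by move=> m; apply/measurable_EFinP; exact: measurable_deficit.
  + by move=> m w _; rewrite lee_fin deficit_ge0.
  apply: (@le_trans _ _ (\sum_(1 <= m < G.+1) (2 * expR (- (c * m0%:R)))%:E)%E).
    rewrite !big_nat; apply: lee_sum => m /andP[_ mG].
    exact: expectation_deficit.
  by rewrite sumEFin lee_fin sumr_const_nat subn1/= [leRHS]mulr_natl.
- move=> w; apply: sume_ge0 => m _.
  by rewrite mule_ge0// lee_fin postM_ge0.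
- move=> w; have -> : 1 - \sum_(1 <= m < G.+1) deficit m w =
      \sum_(1 <= m < G.+1) (pM w m - deficit m w) by rewrite sumrB sum_postM.
  rewrite -sumEFin !big_nat; apply: lee_sum => m mG.
  exact: posterior_mass_deficit.
Qed.

Lemma integral_posterior_le1 :
  (\int[P]_w \sum_(1 <= m < G.+1) (pM w m)%:E * Q (good w m) <= 1)%E.
Proof.
rewrite -[leRHS](probability_setT P) -[leRHS]mul1e -integral_cst//.
apply: ge0_le_integralT => w.
  apply: sume_ge0 => m _.
  by rewrite mule_ge0// lee_fin postM_ge0.
apply: (@le_trans _ _ (\sum_(1 <= m < G.+1) (pM w m)%:E)%E); last first.
  by rewrite sumEFin sum_postM.
apply: lee_sum => m _; rewrite -[leRHS]mule1 lee_wpmul2l ?lee_fin ?postM_ge0//.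
by apply: probability_le1; exact: (measurable_posterior_event lam tau eps iidzeta ell2d).
Qed.

End posterior_concentration.

Unset Implicit Arguments.
Set Strict Implicit.

Theorem mainTheorem13 (R : realType)
  (lam thet eta : nat -> R) (tau : R -> nat -> R) (eps_o d C L : R)
  (dO : measure_display) (Omega : measurableType dO) (P : probability Omega R)
  (xi : nat -> Omega -> R)
  (dQ : measure_display) (Omega' : measurableType dQ) (Q : probability Omega' R)
  (zeta : nat -> Omega' -> R) :
  bounded_seq lam ->
  (forall k, lam k != 0) ->
  ell2 thet ->
  ell2 (fun k => thet k - eta k) ->
  (forall eps, 0 < eps < 1 -> forall k, 0 < tau eps k) ->
  0 < eps_o < 1 ->
  iid_std_normal P xi ->
  iid_std_normal Q zeta ->
  AssumptionA lam tau d ->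
  AssumptionE lam C L ->
  AssumptionO lam thet eta eps_o ->
  (fun eps => ln (Geps lam eps)%:R / (mo lam thet eta eps)%:R : R) @ (0:R)^'+ --> (0:R) ->
  let K := Ko lam thet eta d C L eps_o in
  (* data Y_j = lambda_j theta_j + sqrt eps xi_j *)
  let Y eps w k := lam k * thet k + Num.sqrt eps * xi k w in
  (* a draw from the posterior P_{vartheta^m | Y = y}: independent coordinates
     N(thetaY_j, sigma_j) for j <= m, and eta_j for j > m *)
  let vth eps m y w' k :=
    if (k < m)%N then thetaY lam tau eta eps y k + Num.sqrt (sig lam tau eps k) * zeta k w'
    else eta k in
  (* P_{vartheta^M | Y}( K^-1 Phi <= ||vartheta^M - theta||^2 <= K Phi ) *)
  let post eps w : \bar R :=
    (\sum_(1 <= m < (Geps lam eps).+1)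
       (postM lam tau eta C eps (Y eps w) m)%:E *
       Q [set w' | ((K^-1 * Phio lam thet eta eps)%:E <=
                      sqnorm (fun k => (vth eps m (Y eps w) w' k - thet k)%R))
                   && (sqnorm (fun k => (vth eps m (Y eps w) w' k - thet k)%R) <=
                      (K * Phio lam thet eta eps)%:E)])%E in
  (fun eps => (\int[P]_w post eps w)%E) @ (0:R)^'+ --> (1%:E : \bar R).
Proof.
move=> bndlam lam0 _ ell2d tau_gt0 eps_o01 iidxi iidzeta [d0 hA] hE hO hG K Y vth post.
have /andP[eps_o0 _] := eps_o01.
set kappa := kappao lam thet eta eps_o in K post *.
have kappa01 : 0 < kappa <= 1.
  by rewrite hO; exact: (kappao_le1 ell2d lam0 bndlam eps_o01).
have /andP[kappa0 _] := kappa01.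
have [C1 L1 _ _ _] := hE.
have D_ge : 5 * L / kappa <= (Do lam thet eta L eps_o)%:R.
  have q0 : 0 <= 5 * L / kappa by rewrite divr_ge0 ?(ltW kappa0)//; lra.
  apply: le_trans (ceil_ge _) _.
  by rewrite /Do -/kappa natr_absz ler_int ler_norm.
pose c := (8 * L * (1 + d^-1))^-1.
have c0 : 0 < c.
  have : 0 < d^-1 by rewrite invr_gt0.
  by move=> ?; rewrite invr_gt0 !mulr_gt0//; lra.
have near_bounds (e : R) : 0 < e -> \forall eps \near (0:R)^'+,
    (((1 - e)%:E <= \int[P]_w post eps w) /\ (\int[P]_w post eps w <= 1))%E.
  move=> e0; near=> eps.
  have eps0 : 0 < eps by near: eps; exact: nbhs_right_gt.
  have epso : eps < eps_o by near: eps; exact: nbhs_right_lt.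
  have eps01 : 0 < eps < 1.
    by rewrite eps0/=; case/andP: (eps_o01) => _; exact: lt_trans.
  have epsI : 0 < eps < eps_o by rewrite eps0.
  have m2 : (2 <= mo lam thet eta eps)%N.
    by near: eps; exact: (near_mo_ge ell2d lam0 bndlam eps_o01).
  have mG : (mo lam thet eta eps <= Geps lam eps)%N.
    by near: eps; exact: (near_mo_le_Geps ell2d lam0 bndlam hE).
  have small : (Geps lam eps)%:R * expR (- (c * (mo lam thet eta eps)%:R)) < e / 2.
    near: eps; apply: (near_Geps_expR ell2d lam0 bndlam eps_o01 hO hE hG c0).
    by rewrite divr_gt0.
  have := kappao_Phio_le ell2d lam0 bndlam epsI.
  rewrite le_min => /andP[hb hv].
  split; last first.
    exact: (integral_posterior_le1 tau d C L (Phio lam thet eta eps)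
      (Do lam thet eta L eps_o) P xi iidzeta ell2d m2 mG).
  apply: le_trans (integral_posterior_ge iidxi iidzeta ell2d lam0 eps01
    (tau_gt0 eps eps01) d0 (hA eps eps01) hE kappa01
    (Phio_gt0 thet eta lam0 bndlam eps0) m2 mG (bias_mo_le_Phio _ _ _ _)
    (var_mo_le_Phio _ _ _ _) hb hv D_ge).
  rewrite lee_fin lerD2l lerN2 mulrCA -/c; lra.
have fin_of (x : \bar R) e : ((1 - e)%:E <= x)%E -> (x <= 1)%E -> x \is a fin_num.
  by case: x => [x| |].
apply/fine_cvgP; split.
  near=> eps.
  have [h1 h2] : (((1 - 1)%:E <= \int[P]_w post eps w) /\
      (\int[P]_w post eps w <= 1))%E by near: eps; exact: near_bounds ltr01.
  exact: fin_of h1 h2.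
apply/cvgrPdist_le => e e0; near=> eps.
have [h1 h2] : (((1 - e)%:E <= \int[P]_w post eps w) /\
    (\int[P]_w post eps w <= 1))%E by near: eps; exact: near_bounds.
rewrite /=; move: h1 h2; case: (\int[P]_w post eps w)%E => [x| |]//.
rewrite !lee_fin => h1 h2; rewrite ger0_norm ?subr_ge0//=; lra.
Unshelve. all: by end_near. Qed.
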